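(* Let $(G_n)_n$ be a sequence of connected graphs, $G_n=(V_n,E_n)$ with $|V_n|=n$ and maximum degree $\Delta_n$. (1) If $\sup_n \big(n\Delta_n/|E_n|\big)<\infty$, then the consensus opinion of the voter model on $(G_n)_n$ is dynamically exclusion stable, i.e. for every $\delta>0$ there exists $t>0$ such that for every $n$, $\mathbb{P}\big(f_n(\eta_0,\omega)\ne f_n(\eta_0,\omega_t)\big)\le\delta$. (2) For any such sequence of connected graphs (without assuming the supremum in (1) is finite) and any sequence of times $t_n\ge 0$, $$\lim_{n\to\infty}\frac{t_n\,n\,\Delta_n}{|E_n|}=0\quad\Longrightarrow\quad\lim_{n\to\infty}\mathbb{E}\big[f_n(\eta_0,\omega)\cdot f_n(\eta_0,\omega_{t_n})\big]=p.$$
   Context: Graphs are finite, simple and undirected; $n\ge2$, so that $E_n\neq\emptyset$. $\vec E_n$ denotes the set of directed edges: each $\{x,y\}\in E_n$ gives two directed edges $(x,y)$ and $(y,x)$. Voter model. Fix $p\in(0,1)$ (the same for all $n$). The initial configuration $\eta_0\in\{0,1\}^{V_n}$ has i.i.d. Bernoulli($p$) entries. The sequence $\omega=(\omega(k))_{k\ge1}$ consists of i.i.d. uniform elements of $\vec E_n$ and is independent of $\eta_0$. If $\omega(k+1)=(x,y)$, then $\eta_{k+1}(y)=\eta_k(x)$ and $\eta_{k+1}(z)=\eta_k(z)$ for $z\ne y$. Almost surely $\eta_k$ is eventually constant equal to the all-0 or the all-1 configuration; $f_n(\eta_0,\omega)\in\{0,1\}$ denotes this final common opinion. Interchange noise.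 The interchange process $(\zeta_t)_{t\ge0}$ on $\mathbb{N}=\{1,2,\dots\}$ is started from $\zeta_0(k)=k$, and for every $k\ge1$ the values at the neighbouring positions $k$ and $k+1$ are swapped at rate one, independently for different $k$. It is independent of $(\eta_0,\omega)$. For each $t$, $\zeta_t$ is a permutation of $\mathbb{N}$, and $\omega_t(k):=\omega(\zeta_t(k))$ for $k\ge1$. *)

(* Defs.v *)
From HB Require Import structures.
From mathcomp Require Import all_boot all_order all_algebra.
From mathcomp Require Import finmap.
From mathcomp Require Import all_classical all_reals all_analysis.

Set Implicit Arguments.
Unset Strict Implicit.
Unset Printing Implicit Defensive.

Import Order.TTheory GRing.Theory Num.Theory.

Local Open Scope classical_set_scope.
Local Open Scope ring_scope.

Record sgraph := SGraph {
  vertex :> finType;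
  adj : rel vertex;
  adj_sym : symmetric adj;
  adj_irr : irreflexive adj }.

Definition graph_connected (G : sgraph) : Prop :=
  forall x y : G, connect (@adj G) x y.

Definition dart (G : sgraph) := {xy : G * G | adj xy.1 xy.2}.

Definition edges (G : sgraph) : {set {set G}} :=
  [set [set (val a).1; (val a).2]%SET | a : dart G]%SET.

Definition max_degree (G : sgraph) : nat :=
  (\max_(x : G) #|[set y : G | adj x y]%SET|)%N.

Definition degree_ratio (R : realType) (G : sgraph) : R :=
  #|G|%:R * (max_degree G)%:R / #|edges G|%:R.

(* Steps of the voter model and positions of the interchange process are
   indexed from 0 instead of 1: [om k] is the directed edge used at step
   k + 1, and the sites 1, 2, ... become 0, 1, ... *)

Fixpoint voter (G : sgraph) (eta0 : G -> bool) (om : nat -> dart G) (k : nat)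
    : G -> bool :=
  if k is k'.+1 then
    fun z => let: (x, y) := val (om k') in
      if z == y then voter eta0 om k' x else voter eta0 om k' z
  else eta0.

(* On the null event without consensus the value is [false]. *)
Definition consensus (G : sgraph) (eta0 : G -> bool) (om : nat -> dart G)
    : bool :=
  `[< exists K, forall k, (K <= k)%N -> forall x, voter eta0 om k x = true >].

Definition sigma_discrete (T E : Type) (X : T -> E) : set (set T) :=
  preimage_set_system [set: T] X [set: set E].

Definition sigma_family (T E I : Type) (D : set I) (X : I -> T -> E)
    : set (set T) :=
  <<s \bigcup_(i in D) sigma_discrete (X i) >>.

Section independence.
Context (R : realType) (d : measure_display) (T : measurableType d)
  (P : probability T R).

Definition independent (F1 F2 : set (set T)) : Prop :=
  forall A B, F1 A -> F2 B -> P (A `&` B) = (P A * P B)%E.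

Definition mutually_independent (I : choiceType) (F : I -> set (set T))
    : Prop :=
  forall (J : {fset I}) (A : I -> set T),
    (forall i, i \in J -> F i (A i)) ->
    P (\bigcap_(i in [set` J]) A i) = (\prod_(i <- J) P (A i))%E.

End independence.

Section interchange.
Context (R : realType) (d : measure_display) (T : measurableType d)
  (P : probability T R).

(* [tau j i] is the waiting time between the i-th and (i+1)-st rings of the
   clock attached to the pair of positions j, j + 1. *)
Definition rings (tau : nat -> nat -> T -> R) (w : T) (j : nat) (t : R) : Prop :=
  exists i, t = \sum_(0 <= l < i.+1) tau j l w.

(* [z t k] is the value at position k at time t.  The clauses are: initial
   condition; position k does not change while neither of the two clocks
   touching it rings; the values at j and j + 1 just before a ring of clock j
   are swapped by it.  Almost surely there are no simultaneous rings and, on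
   each [0, t], the silent clocks cut the sites into finite blocks, so that
   the path is determined by the clocks. *)
Definition interchange_path (ring : nat -> R -> Prop) (z : R -> nat -> nat)
    : Prop :=
  [/\ forall k, z 0 k = k,
      forall k s t, 0 <= s -> s <= t ->
        (forall j u, j = k \/ j.+1 = k -> s < u -> u <= t -> ~ ring j u) ->
        z t k = z s k
    & forall j t, 0 < t -> ring j t ->
        exists s, [/\ 0 <= s, s < t &
          forall u, s <= u -> u < t -> z t j = z u j.+1 /\ z t j.+1 = z u j]].

Definition rate_one_clocks (tau : nat -> nat -> {RV P >-> R}) : Prop :=
  (forall j i (A : set R), measurable A ->
     distribution P (tau j i) A = exponential_prob 1 A) /\
  mutually_independent P
    (fun ji : nat * nat => g_sigma_algebra_preimage (tau ji.1 ji.2)).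

Definition interchange_process (zeta : R -> nat -> T -> nat) : Prop :=
  (forall t k, 0 <= t -> measurable_fun [set: T] (zeta t k)) /\
  exists tau : nat -> nat -> {RV P >-> R}, rate_one_clocks tau /\
    {ae P, forall w, interchange_path (rings tau w) (fun t k => zeta t k w)}.

End interchange.

Section model.
Context (R : realType) (p : R) (G : sgraph) (d : measure_display)
  (T : measurableType d) (P : probability T R).

Record bernoulli_opinions (eta0 : G -> T -> bool) : Prop := {
  eta0_measurable : forall x, measurable_fun [set: T] (eta0 x);
  eta0_law : forall x, P [set w | eta0 x w = true] = p%:E;
  eta0_indep : mutually_independent P (fun x => sigma_discrete (eta0 x)) }.

Record uniform_darts (omega : nat -> T -> dart G) : Prop := {
  omega_measurable : forall k a, measurable [set w | omega k w = a];
  omega_law : forall k a,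
    P [set w | omega k w = a] = (#|{: dart G}|%:R^-1)%:E;
  omega_indep : mutually_independent P (fun k => sigma_discrete (omega k)) }.

Definition sigma_interchange (zeta : R -> nat -> T -> nat) : set (set T) :=
  sigma_family [set tk : R * nat | 0 <= tk.1] (fun tk => zeta tk.1 tk.2).

Record voter_interchange_model (eta0 : G -> T -> bool)
    (omega : nat -> T -> dart G) (zeta : R -> nat -> T -> nat) : Prop := {
  vim_eta0 : bernoulli_opinions eta0;
  vim_omega : uniform_darts omega;
  vim_eta0_omega :
    independent P (sigma_family setT eta0) (sigma_family setT omega);
  vim_zeta : interchange_process P zeta;
  vim_zeta_indep :
    independent P (sigma_interchange zeta)
      <<s sigma_family setT eta0 `|` sigma_family setT omega >> }.

End model.

Section outcome.
Context (R : realType) (G : sgraph) (T : Type).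

Definition noisy (omega : nat -> T -> dart G) (zeta : R -> nat -> T -> nat)
    (t : R) : nat -> T -> dart G :=
  fun k w => omega (zeta t k w) w.

Definition outcome (eta0 : G -> T -> bool) (omega : nat -> T -> dart G) (w : T)
    : bool :=
  consensus (fun x => eta0 x w) (fun k => omega k w).

End outcome.

(* Main.v *)
Require Import Defs.
From HB Require Import structures.
From mathcomp Require Import all_boot all_order all_algebra perm.
From mathcomp Require Import finmap.
From mathcomp Require Import all_classical all_reals all_analysis.
From mathcomp Require Import measurable_realfun.
From mathcomp Require Import zify ring lra.
Import Order.TTheory GRing.Theory Num.Theory.
Import numFieldNormedType.Exports.
Local Open Scope classical_set_scope.
Local Open Scope ring_scope.

(* Let [ancestor om k x] be the vertex whose initial opinion sits at [x] after
   [k] steps: then [eta_k = eta_0 o ancestor om k], and the outcome is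
   [eta_0 root] once this map is constant, with value [root].  Since the root
   depends on [omega] only, [P(f = 1) = p] as soon as consensus is almost sure.

   The energy #{(u, v) | A u = A v} of the ancestor map [A] grows on average by
   (2 / m) #{darts across which A disagrees} per step, [m] being the number of
   darts, and is at most n^2.  So the expected numbers of disagreeing darts have
   a finite sum, at most m n^2 / 2; this gives almost sure consensus.

   The Hamming distance of two maps is a martingale when both are updated with
   the same random dart, because darts come in opposite pairs.  Exchanging the
   darts at times j and j + 1 matters only if they share a vertex, and then
   costs at most 2 for each of the two that is disagreeing.  Summing over j, the
   expected number of vertices whose ancestor is altered is at most
   8 Delta n^2 / m, whatever the horizon, hence the root is altered with total
   probability at most 8 Delta n / m.

   Finally, for t <= 1/2 clock j rings on average at most 2 t times before
   time t, and silent clocks cut the sites into finite blocks, on which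
   [zeta_t] is a product of adjacent swaps, one for each ring.  As [zeta] is
   independent of the uniform darts, the outcome changes with probability at
   most 16 t Delta n / m, where m >= |E_n|. *)

Set Implicit Arguments.
Unset Strict Implicit.
Unset Printing Implicit Defensive.

(** * Ancestors *)

Section ancestors.
Variable G : sgraph.

Definition copy_step (V : Type) (a : dart G) (A : G -> V) : G -> V :=
  fun z => if z == (val a).2 then A (val a).1 else A z.

Fixpoint ancestor (om : nat -> dart G) (k : nat) : G -> G :=
  if k is k'.+1 then copy_step (om k') (ancestor om k') else id.

Definition dart_rev (a : dart G) : dart G :=
  Sub ((val a).2, (val a).1) (etrans (adj_sym _ _) (valP a)).

Lemma dart_revK : involutive dart_rev.
Proof. by move=> a; apply: val_inj; rewrite !SubK /= -surjective_pairing. Qed.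

Lemma voterE (eta0 : G -> bool) om k z :
  voter eta0 om k z = eta0 (ancestor om k z).
Proof.
elim: k z => //= k IH z; rewrite /copy_step /=.
by case: (sval (om k)) => x y /=; rewrite !IH; case: ifP.
Qed.

Lemma eq_ancestor om om' k : (forall i, (i < k)%N -> om i = om' i) ->
  ancestor om k =1 ancestor om' k.
Proof.
elim: k => //= k IH H z; rewrite /copy_step H //.
by rewrite !IH // => i ik; apply: H; rewrite ltnW.
Qed.

Lemma ancestor_const om k K x : (k <= K)%N ->
  (forall z, ancestor om k z = x) -> forall z, ancestor om K z = x.
Proof.
move=> /subnK <-; elim: (K - k)%N => //= i IH H z.
by rewrite /copy_step !IH //; case: ifP.
Qed.

Lemma consensus_ancestor (eta0 : G -> bool) om M x :
  (forall z, ancestor om M z = x) -> consensus eta0 om = eta0 x.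
Proof.
move=> H; rewrite /consensus; have HK k z : (M <= k)%N -> voter eta0 om k z = eta0 x.
  by move=> Mk; rewrite voterE (ancestor_const Mk H).
(* If the common opinion is 0, the all-1 state required by [consensus] would have to hold at time
   [maxn K M], where every opinion is already [eta0 x]. *)
case E: (eta0 x).
  by apply/asboolP; exists M => k Mk z; rewrite HK.
apply/asboolPn => -[K HKK]; have := HKK (maxn K M) (leq_maxl _ _) x.
by rewrite HK ?leq_maxr // E.
Qed.

Definition constant_map (A : G -> G) : bool := [exists x, [forall z, A z == x]].

Lemma constant_mapP A : reflect (exists x, forall z, A z = x) (constant_map A).
Proof.
apply: (iffP existsP) => [[x /forallP H]|[x H]]; exists x.
  by move=> z; apply/eqP.
by apply/forallP => z; rewrite H.
Qed.

Lemma constant_ancestorW om k K : (k <= K)%N ->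
  constant_map (ancestor om k) -> constant_map (ancestor om K).
Proof.
move=> kK /constant_mapP [x H]; apply/constant_mapP; exists x.
exact: ancestor_const kK H.
Qed.

End ancestors.

(** * One-step averages of energy and Hamming distance over a uniform dart *)

Section averages.
Variables (R : realType) (G : sgraph).
Implicit Types (A B : G -> G) (a b : dart G).

Definition disagree A a : bool := A (val a).1 != A (val a).2.
Definition disagreements A : R := \sum_a (disagree A a)%:R.
Definition energy A : R := \sum_u \sum_v (A u == A v)%:R.
Definition hamming A B : R := \sum_v (A v != B v)%:R.

Lemma sum_dart_rev (F : dart G -> R) : \sum_a F (dart_rev a) = \sum_a F a.
Proof. by rewrite [RHS](reindex_inj (inv_inj (@dart_revK G))). Qed.

(** Reversing darts exchanges tails and heads. This symmetry cancels all first-order terms in the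
    averages below. *)
Lemma sum_tail_head (F : G -> R) :
  \sum_(a : dart G) F (val a).1 = \sum_(a : dart G) F (val a).2.
Proof. by rewrite -sum_dart_rev. Qed.

Lemma sum_copy (F : G -> R) a :
  \sum_v F (if v == (val a).2 then (val a).1 else v) =
  \sum_v F v + F (val a).1 - F (val a).2.
Proof.
rewrite (bigD1 (val a).2) //= eqxx [in RHS](bigD1 (val a).2) //=.
rewrite (eq_bigr F) => [|v /negbTE ->//]; ring.
Qed.

(** A step precomposes [A] with the map sending the head of the dart to its tail, which is the form
    that [sum_copy] evaluates. *)
Lemma copy_stepE A a v :
  copy_step a A v = A (if v == (val a).2 then (val a).1 else v).
Proof. by rewrite /copy_step; case: ifP. Qed.

(** The terms linear in the endpoints cancel by [sum_tail_head]. What remains is the second-order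
    effect of updating both entries of a pair at once, which is 2 exactly when the dart
    disagrees. *)
Lemma sum_energy A : \sum_a energy (copy_step a A) =
  #|{: dart G}|%:R * energy A + 2 * disagreements A.
Proof.
pose S x : R := \sum_v (A x == A v)%:R.
have E a : energy (copy_step a A) =
    energy A + 2 * (disagree A a)%:R + 2 * (S (val a).1 - S (val a).2).
  (* [T] is the inner sum after the update, by a first use of [sum_copy]; a second use handles the
     outer sum. *)
  pose T u : R := S u + (A u == A (val a).1)%:R - (A u == A (val a).2)%:R.
  have -> : energy (copy_step a A) =
      \sum_u T (if u == (val a).2 then (val a).1 else u).
    apply: eq_bigr => u _; rewrite /T -(sum_copy (fun v => (A _ == A v)%:R)).
    by apply: eq_bigr => v _; rewrite !copy_stepE.
  rewrite sum_copy /T sumrB big_split /= -/(energy A).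
  have SE x : \sum_(i : G) (A i == A x)%:R = S x.
    by apply: eq_bigr => v _; rewrite eq_sym.
  rewrite !SE.
  rewrite !eqxx [A (val a).2 == A (val a).1]eq_sym /disagree.
  by case: (A _ == _) => /=; ring.
rewrite (eq_bigr _ (fun a _ => E a)) !big_split /= sumr_const -!mulr_sumr.
by rewrite sumrB sum_tail_head subrr mulr0 addr0 -[_ *+ _]mulr_natl.
Qed.

(** The distance is a sum of one function over the vertices, so a shared dart changes it by a tail
    term minus a head term, and these cancel on average. *)
Lemma sum_hamming A B : \sum_a hamming (copy_step a A) (copy_step a B) =
  #|{: dart G}|%:R * hamming A B.
Proof.
have E a : hamming (copy_step a A) (copy_step a B) =
   hamming A B + ((A (val a).1 != B (val a).1)%:R
    - (A (val a).2 != B (val a).2)%:R).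
  rewrite addrA -(sum_copy (fun v => (A v != B v)%:R)).
  by apply: eq_bigr => v _; rewrite !copy_stepE.
rewrite (eq_bigr _ (fun a _ => E a)) big_split /= sumr_const -[_ *+ _]mulr_natl.
rewrite sumrB.
by rewrite (sum_tail_head (fun v => (A v != B v)%:R)) subrr addr0.
Qed.

Definition incident a b : bool :=
  [|| (val a).1 == (val b).1, (val a).1 == (val b).2,
      (val a).2 == (val b).1 | (val a).2 == (val b).2].

Lemma incidentC a b : incident a b = incident b a.
Proof.
rewrite /incident ![(val a).1 == _]eq_sym ![(val a).2 == _]eq_sym.
by case: (_ == _); case: (_ == _); case: (_ == _); case: (_ == _).
Qed.

Lemma eq_copy_step A B a : A =1 B -> copy_step a A =1 copy_step a B.
Proof. by move=> AB v; rewrite !copy_stepE AB. Qed.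

Lemma copy_step_agree A a : ~~ disagree A a -> copy_step a A =1 A.
Proof.
by rewrite negbK => /eqP E v; rewrite copy_stepE; case: eqP => // ->.
Qed.

(** The two orders can differ only at the heads of [a] and [b]. Darts without a common vertex
    commute, and two darts across which [A] agrees both act trivially. *)
Lemma hamming_swap A a b :
  hamming (copy_step b (copy_step a A)) (copy_step a (copy_step b A)) <=
  2 * (incident a b)%:R * ((disagree A a)%:R + (disagree A b)%:R).
Proof.
have -> : hamming (copy_step b (copy_step a A)) (copy_step a (copy_step b A))
   = \sum_(v | (v == (val a).2) || (v == (val b).2))
       (copy_step b (copy_step a A) v != copy_step a (copy_step b A) v)%:R.
  rewrite /hamming [LHS](bigID (fun v => (v == (val a).2) || (v == (val b).2))) /=.
  rewrite [X in _ + X]big1 ?addr0 // => v; rewrite negb_or => /andP[/negbTE va /negbTE vb].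
  by rewrite /copy_step va vb eqxx.
(* Only the two heads contribute, hence the factor 2. *)
have le2 (F : G -> R) (c : R) : (forall v, F v <= c) -> 0 <= c ->
   \sum_(v | (v == (val a).2) || (v == (val b).2)) F v <= 2 * c.
  move=> Fc c0; apply: (@le_trans _ _ (\sum_(v | v == (val a).2) c +
     \sum_(v | v == (val b).2) c)); last by rewrite !big_pred1_eq; lra.
  rewrite [X in X + _]big_mkcond [X in _ + X]big_mkcond -big_split /= big_mkcond.
  apply: ler_sum => v _.
  by case: (v == _); case: (v == _); rewrite /= ?addr0 ?add0r //; have := Fc v; lra.
rewrite -mulrA; apply: le2 => [v|]; last by rewrite mulr_ge0 ?addr_ge0.
have T (c : bool) (r : R) : (c -> 1 <= r) -> 0 <= r -> c%:R <= r.
  by case: c => [/(_ isT)|].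
apply: T; last by rewrite mulr_ge0 ?addr_ge0.
have H1 (c c1 c2 : bool) : c -> c1 || c2 -> 1 <= c%:R * (c1%:R + c2%:R) :> R.
  by case: c; case: c1; case: c2 => //= _ _; rewrite !mul1r; lra.
move=> D; apply: H1; apply: contraNT D.
  rewrite /incident !negb_or /copy_step => /and4P[_ /negbTE xy' /negbTE yx' /negbTE yy'].
  rewrite xy' [(val b).1 == _]eq_sym yx'.
  case: (eqVneq v (val a).2) => [->|va]; first by rewrite yy'.
  by case: eqP.
rewrite negb_or => /andP[/copy_step_agree Aa /copy_step_agree Ab].
by rewrite (eq_copy_step _ Aa) (eq_copy_step _ Ab) Aa Ab.
Qed.

Lemma degree_le (x : G) : (#|[set y : G | adj x y]%SET| <= max_degree G)%N.
Proof. by rewrite /max_degree (leq_bigmax x). Qed.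

Lemma sum_tail_eq x : \sum_(a : dart G) ((val a).1 == x)%:R <= (max_degree G)%:R :> R.
Proof.
rewrite -natr_sum ler_nat (leq_trans _ (degree_le x)) //.
have -> : (\sum_(a : dart G) ((val a).1 == x) =
    #|[set a : dart G | (val a).1 == x]%SET|)%N.
  rewrite -sum1dep_card [RHS]big_mkcond /=; apply: eq_bigr => a _.
  by case: ifP.
rewrite -(card_in_imset (f := fun a : dart G => (val a).2)); last first.
  move=> a b; rewrite !inE => /eqP ax /eqP bx ab; apply: val_inj.
  by rewrite [LHS]surjective_pairing [RHS]surjective_pairing ab ax bx.
apply: subset_leq_card; apply/fintype.subsetP => y /imsetP[a]; rewrite !inE => /eqP <- ->.
exact: (valP a).
Qed.

Lemma sum_head_eq x : \sum_(a : dart G) ((val a).2 == x)%:R <= (max_degree G)%:R :> R.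
Proof. by rewrite -(sum_tail_head (fun y => (y == x)%:R)) sum_tail_eq. Qed.

(** Each of the four possible coincidences pins one endpoint of [b] to a given vertex. *)
Lemma sum_incident a : \sum_b (incident a b)%:R <= 4 * (max_degree G)%:R :> R.
Proof.
apply: (@le_trans _ _ (\sum_b (((val b).1 == (val a).1)%:R +
   ((val b).2 == (val a).1)%:R + ((val b).1 == (val a).2)%:R +
   ((val b).2 == (val a).2)%:R))).
  apply: ler_sum => b _; rewrite /incident ![(val b).1 == _]eq_sym ![(val b).2 == _]eq_sym.
  by case: (_ == _); case: (_ == _); case: (_ == _); case: (_ == _);
    rewrite /= ?addr0 ?add0r -?natrD ?ler_nat.
rewrite !big_split /=.
have := sum_tail_eq (val a).1; have := sum_tail_eq (val a).2.
have := sum_head_eq (val a).1; have := sum_head_eq (val a).2.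
lra.
Qed.

(** The constant is 2 from [hamming_swap], times 4 from [sum_incident], times 2 for the symmetry
    between [a] and [b]. *)
Lemma sum_hamming_swap A :
  \sum_a \sum_b hamming (copy_step b (copy_step a A)) (copy_step a (copy_step b A))
  <= 16 * (max_degree G)%:R * disagreements A.
Proof.
pose F a b : R := 2 * (incident a b)%:R * (disagree A a)%:R.
have FS : \sum_a \sum_b F a b <= 8 * (max_degree G)%:R * disagreements A.
  rewrite /disagreements mulr_sumr; apply: ler_sum => a _.
  rewrite -mulr_suml ler_wpM2r // -mulr_sumr; have := sum_incident a; lra.
apply: (@le_trans _ _ (\sum_a \sum_b (F a b + F b a))).
  apply: ler_sum => a _; apply: ler_sum => b _.
  by apply: (le_trans (hamming_swap A a b)); rewrite /F [incident b a]incidentC mulrDr.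
under eq_bigr do rewrite big_split /=.
by rewrite big_split /= [X in _ + X]exchange_big /=; lra.
Qed.

Lemma hamming_ge0 A B : 0 <= hamming A B.
Proof. by apply: sumr_ge0. Qed.

Lemma hamming_eq0 A B : A =1 B -> hamming A B = 0.
Proof. by move=> AB; rewrite /hamming big1 // => v _; rewrite AB eqxx. Qed.

Lemma eq_hamming A A' B B' : A =1 A' -> B =1 B' -> hamming A B = hamming A' B'.
Proof. by move=> E E'; apply: eq_bigr => v _; rewrite E E'. Qed.

Lemma hamming_triangle B A C : hamming A C <= hamming A B + hamming B C.
Proof.
rewrite -big_split; apply: ler_sum => v _ /=.
case: (eqVneq (A v) (B v)) => [->|_]; first by rewrite add0r.
by case: (_ != _); rewrite ?lerDl // addr_ge0.
Qed.

Lemma hamming_le A B : hamming A B <= #|G|%:R.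
Proof.
rewrite /hamming -natr_sum ler_nat -sum1_card; apply: leq_sum => v _.
exact: leq_b1.
Qed.

Lemma energy_ge0 A : 0 <= energy A.
Proof. by apply: sumr_ge0 => u _; apply: sumr_ge0. Qed.

Lemma energy_le A : energy A <= #|G|%:R ^+ 2.
Proof.
rewrite /energy; under eq_bigr do rewrite -natr_sum.
rewrite -natr_sum -natrX ler_nat expnS expn1 -sum_nat_const; apply: leq_sum => u _.
by rewrite -[leqRHS]sum1_card; apply: leq_sum => v _; exact: leq_b1.
Qed.

Lemma eq_energy A B : A =1 B -> energy A = energy B.
Proof.
by move=> E; apply: eq_bigr => u _; apply: eq_bigr => v _; rewrite !E.
Qed.

Lemma disagreements_ge0 A : 0 <= disagreements A.
Proof. by apply: sumr_ge0. Qed.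

(** The count is an integer, so a value below 1 means agreement across every dart, and connectedness
    spreads the value at [x0] to all vertices. *)
Lemma disagreements_nonconstant A (x0 : G) : graph_connected G ->
  ~~ constant_map A -> 1 <= disagreements A.
Proof.
move=> conn; apply: contraNT; rewrite -ltNge => lt1.
have H a : A (val a).1 = A (val a).2.
  apply/eqP; apply: contraTT lt1 => Aa; rewrite -leNgt.
  by rewrite /disagreements (bigD1 a) //= {1}/disagree Aa lerDl sumr_ge0.
apply/constant_mapP; exists (A x0) => z.
have closedA : closed_mem (@adj G) (mem [pred y | A y == A x0]).
  by move=> y y' yy'; rewrite !inE (H (Sub (y, y') yy')).
by have := closed_connect closedA (conn x0 z); rewrite !inE eqxx => /esym /eqP.
Qed.

End averages.

(** * Uniform sequences of darts *)

Section dart_sequences.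
Variables (R : realType) (G : sgraph) (N : nat).
Local Notation seqs := {ffun 'I_N.+1 -> dart G}.
Local Notation m := (#|{: dart G}|%:R : R).

(** Indices beyond [N] fall back on index 0; the ancestor maps of interest read indices up to [N]
    only. *)
Definition extend (om : seqs) : nat -> dart G := fun i => om (inord i).

Definition update (om : seqs) (i : 'I_N.+1) (a : dart G) : seqs :=
  [ffun j => if j == i then a else om j].

(* [(a, om) |-> (om i, update om i a)] is an involution. *)
Lemma sum_update (F : seqs -> R) i :
  \sum_a \sum_om F (update om i a) = m * \sum_om F om.
Proof.
rewrite pair_big /=.
pose g (u : dart G * seqs) := (u.2 i, update u.2 i u.1).
have gK : involutive g.
  move=> [a om]; rewrite /g /= ffunE eqxx; congr pair.
  by apply/ffunP => j; rewrite !ffunE; case: eqP => // ->.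
rewrite (reindex_inj (inv_inj gK)) /=.
rewrite (eq_bigr (fun u => F u.2)); last first.
  move=> [a om] _ /=; congr F; apply/ffunP => j; rewrite !ffunE.
  by case: eqP => // ->.
by rewrite -(pair_bigA _ (fun (_ : dart G) om => F om)) /= sumr_const [RHS]mulr_natl.
Qed.

(** The coordinate [i] of a uniform sequence may be replaced by a fresh uniform dart in any
    expression that reads it through the second argument of [Phi] only. *)
Lemma sum_resample (Phi : seqs -> dart G -> R) i :
  (forall om a b, Phi (update om i a) b = Phi om b) ->
  m * \sum_om Phi om (om i) = \sum_om \sum_a Phi om a.
Proof.
move=> PhiE; rewrite -(sum_update _ i) exchange_big /=.
apply: eq_bigr => om _; apply: eq_bigr => a _.
by rewrite PhiE ffunE eqxx.
Qed.

Lemma extend_update om k a i : (i < N.+1)%N -> (k < N.+1)%N -> i != k ->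
  extend (update om (inord k) a) i = extend om i.
Proof.
move=> iN kN ik; rewrite /extend ffunE ifN //.
by apply: contraNneq ik => /(congr1 val) /=; rewrite !inordK // => ->.
Qed.

Lemma ancestor_update om k a j : (j <= k)%N -> (k < N.+1)%N ->
  ancestor (extend (update om (inord k) a)) j =1 ancestor (extend om) j.
Proof.
move=> jk kN; apply: eq_ancestor => i ij; apply: extend_update => //; lia.
Qed.

(** By [sum_energy] the sum telescopes to an increment of the total energy, which stays between 0
    and its maximum. *)
Lemma sum_disagreements M : (M <= N.+1)%N ->
  2 * \sum_(0 <= k < M) \sum_om disagreements R (ancestor (extend om) k)
  <= m * #|{: seqs}|%:R * #|G|%:R ^+ 2.
Proof.
pose e k := \sum_om energy R (ancestor (extend om) k).
have e_le k : e k <= #|{: seqs}|%:R * #|G|%:R ^+ 2.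
  apply: (@le_trans _ _ (\sum_(om : seqs) #|G|%:R ^+ 2)).
    by apply: ler_sum => om _; exact: energy_le.
  by rewrite sumr_const -[_ *+ #|_|]mulr_natl.
have e_ge0 k : 0 <= e k by apply: sumr_ge0 => om _; exact: energy_ge0.
have eS k : (k < N.+1)%N -> m * e k.+1 =
    m * e k + 2 * \sum_om disagreements R (ancestor (extend om) k).
  move=> kN; rewrite /e /=.
  rewrite (sum_resample
    (Phi := fun om a => energy R (copy_step a (ancestor (extend om) k)))).
    rewrite /=; under eq_bigr do rewrite sum_energy.
    by rewrite big_split /= -!mulr_sumr.
  move=> om a b; apply: eq_energy; apply: eq_copy_step.
  exact: ancestor_update.
have H k : (k <= N.+1)%N -> 2 * \sum_(0 <= k < k)
    \sum_om disagreements R (ancestor (extend om) k) = m * e k - m * e 0%N.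
  elim: k => [|k IH] kN; first by rewrite big_geq // mulr0 subrr.
  by rewrite big_nat_recr //= mulrDr IH ?(ltnW kN) // eS //; lra.
move=> MN; rewrite H // -mulrA -mulrBr ler_wpM2l //.
have := e_le M; have := e_ge0 0%N; lra.
Qed.

(** If the map is not constant at time [M], it was not constant at any earlier time, so each of the
    [M] earlier steps had at least one disagreeing dart. *)
Lemma sum_nonconstant M (x0 : G) : graph_connected G -> (M <= N.+1)%N ->
  M%:R * \sum_om (~~ constant_map (ancestor (extend om) M))%:R
  <= m * #|{: seqs}|%:R * #|G|%:R ^+ 2 :> R.
Proof.
move=> conn MN.

apply: le_trans (sum_disagreements MN).
have -> (x : R) : M%:R * x = \sum_(0 <= k < M) x.
  by rewrite sumr_const_nat subn0 mulr_natl.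
set S := (X in 2 * X).
have S0 : 0 <= S.
  by do 2 (apply: sumr_ge0 => ? _); exact: disagreements_ge0.
suff : \sum_(0 <= k < M) \sum_om (~~ constant_map (ancestor (extend om) M))%:R <= S.
  by lra.
rewrite /S !big_nat; apply: ler_sum => k /andP[_ kM]; apply: ler_sum => om _.
case: (boolP (constant_map _)) => [_|nM]; first exact: disagreements_ge0.
apply: (disagreements_nonconstant R x0 conn).
by apply: contra nM; apply: constant_ancestorW; rewrite ltnW.
Qed.

(** * Permuted sequences and the influence of adjacent swaps *)

Definition permute (s : {perm 'I_N.+1}) (om : seqs) : seqs :=
  [ffun i => om (s i)].

Lemma permuteM s s' om : permute s (permute s' om) = permute (s * s')%g om.
Proof. by apply/ffunP => i; rewrite !ffunE permM. Qed.

Lemma permute_inj s : injective (permute s).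
Proof.
move=> om om' /ffunP E; apply/ffunP => i.
by have := E (s^-1 i)%g; rewrite !ffunE permKV.
Qed.

Definition swap_perm (j : nat) : {perm 'I_N.+1} := tperm (inord j) (inord j.+1).

(* Expectations over [seqs] are left unnormalised: a factor [#|seqs|] is
   missing, here and in [displacement]. *)
Definition influence (M j : nat) : R :=
  \sum_om hamming R (ancestor (extend om) M)
                    (ancestor (extend (permute (swap_perm j) om)) M).

Lemma extend_swap om j i : (i < N.+1)%N -> (j.+1 < N.+1)%N ->
  extend (permute (swap_perm j) om) i =
  extend om (if i == j then j.+1 else if i == j.+1 then j else i).
Proof.
move=> iN jN; rewrite /extend ffunE; congr (om _).
have inord_eq k : (k < N.+1)%N -> (inord k == inord i :> 'I_N.+1) = (k == i).
  move=> kN; apply/eqP/eqP => [/(congr1 val)|-> //].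
  by rewrite /= !inordK.
have jN' := ltnW jN.
case: (eqVneq i j) => [->|ij]; first by rewrite tpermL.
case: (eqVneq i j.+1) => [->|ij']; first by rewrite tpermR.
by rewrite tpermD // inord_eq // eq_sym.
Qed.

(** At horizon [j.+2] the two sequences differ only in the order of their last two darts, and these
    can be resampled given the first [j]. *)
Lemma influence_commute j :  (j.+1 < N.+1)%N ->
  m ^+ 2 * influence j.+2 j =
  \sum_om \sum_a \sum_b hamming R
    (copy_step b (copy_step a (ancestor (extend om) j)))
    (copy_step a (copy_step b (ancestor (extend om) j))).
Proof.
move=> jN; have jN' := ltnW jN.
pose H om a b := hamming R (copy_step b (copy_step a (ancestor (extend om) j)))
    (copy_step a (copy_step b (ancestor (extend om) j))).
have HE om k a : (j <= k)%N -> (k < N.+1)%N -> forall b c,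
    H (update om (inord k) a) b c = H om b c.
  move=> jk kN b c.
  by apply: eq_hamming; do 2 apply: eq_copy_step; apply: ancestor_update.
(* The two coordinates are resampled one at a time: here [j.+1], then [j]. *)
transitivity (m * \sum_om \sum_a H om a (om (inord j.+1))); last first.
  rewrite (sum_resample (Phi := fun om b => \sum_a H om a b)).
    by apply: eq_bigr => om _; rewrite exchange_big.
  by move=> om a b; apply: eq_bigr => c _; apply: HE.
rewrite expr2 -mulrA; congr (_ * _).
rewrite -(sum_resample (i := inord j) (Phi := fun om a => H om a (om (inord j.+1)))).
  congr (_ * _); apply: eq_bigr => om _; rewrite /influence /H /=.
  apply: eq_hamming => //; rewrite !extend_swap // eqxx ifN ?eqxx; last first.
    by rewrite neq_ltn ltnSn orbT.
  do 2 apply: eq_copy_step; apply: eq_ancestor => i ij.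
  by rewrite extend_swap ?(ltn_trans ij) // !ifN //; apply/eqP; lia.
move=> om a b; rewrite HE // /H; congr (H _ _ _).
rewrite /H ffunE ifN //; apply/eqP => /(congr1 val) /=; rewrite !inordK //; lia.
Qed.

Lemma ancestor_swap_update om j k a : (j.+1 < k)%N -> (k < N.+1)%N ->
  ancestor (extend (permute (swap_perm j) (update om (inord k) a))) k =1
  ancestor (extend (permute (swap_perm j) om)) k.
Proof.
move=> jk kN; apply: eq_ancestor => i ik; rewrite !extend_swap ?(ltn_trans _ kN) //.
set i' := if _ then _ else _.
have ik' : (i' < k)%N by rewrite /i'; case: ifP => _; [|case: ifP => _]; lia.
by rewrite extend_update ?(ltn_trans ik') // neq_ltn ik'.
Qed.

(** Beyond the swapped positions both sequences apply the same fresh dart, so [sum_hamming] keeps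
    the average distance unchanged. *)
Lemma influence_step M j : (0 < #|{: dart G}|)%N -> (j.+1 < M)%N -> (M < N.+1)%N ->
  influence M.+1 j = influence M j.
Proof.
move=> m0 jM MN; have mN0 : m != 0 by rewrite pnatr_eq0 -lt0n.
apply: (mulfI mN0).
pose Phi om a := hamming R (copy_step a (ancestor (extend om) M))
   (copy_step a (ancestor (extend (permute (swap_perm j) om)) M)).
transitivity (m * \sum_om Phi om (om (inord M))).
  congr (_ * _); apply: eq_bigr => om _; apply: eq_hamming => //= v.
  by rewrite extend_swap ?(ltn_trans jM) // !ifN //; apply/eqP; lia.
rewrite sum_resample; last first.
  move=> om a b; apply: eq_hamming; apply: eq_copy_step.
    exact: ancestor_update.
  exact: ancestor_swap_update.
by rewrite /Phi; under eq_bigr do rewrite sum_hamming; rewrite -mulr_sumr.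
Qed.

Lemma influence_stable M j : (0 < #|{: dart G}|)%N -> (j.+1 < M)%N ->
  (M <= N.+1)%N -> influence M j = influence j.+2 j.
Proof.
move=> m0; elim: M => // M IH; rewrite ltnS leq_eqVlt => /orP[/eqP <- //|jM] MN.
by rewrite influence_step // IH // ltnW.
Qed.

(** Each influence is its value right after the swap, bounded through [sum_hamming_swap]; summing
    over [j] turns the disagreements into energy, which halves the constant 16. *)
Lemma sum_influence M : (0 < #|{: dart G}|)%N -> (M < N.+1)%N ->
  m * \sum_(0 <= j < M) influence M.+1 j <=
  8 * (max_degree G)%:R * #|{: seqs}|%:R * #|G|%:R ^+ 2.
Proof.
move=> m0 MN; have m_gt0 : 0 < m by rewrite ltr0n.
rewrite -(ler_pM2l m_gt0) mulrA -expr2 mulr_sumr.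
apply: (@le_trans _ _ (\sum_(0 <= j < M)
    16 * (max_degree G)%:R * \sum_om disagreements R (ancestor (extend om) j))).
  rewrite !big_nat; apply: ler_sum => j /andP[_ jM].
  rewrite influence_stable // influence_commute ?(leq_ltn_trans _ MN) //.
  by rewrite mulr_sumr; apply: ler_sum => om _; exact: sum_hamming_swap.
rewrite -mulr_sumr; have := sum_disagreements (ltnW MN); set S := \sum_(0 <= k < M) _.
move=> /(ler_wpM2l (x := 8 * (max_degree G)%:R)) H.
by have := H (mulr_ge0 (ler0n _ 8) (ler0n _ _)); lra.
Qed.

(** This swap straddles the horizon: it brings in the unread dart [k.+1]. It has no effect once the
    ancestor map is constant. *)
Lemma influence_edge k : (k.+1 < N.+1)%N -> influence k.+1 k <=
  #|G|%:R * \sum_om (~~ constant_map (ancestor (extend om) k))%:R.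
Proof.
move=> kN; rewrite /influence mulr_sumr; apply: ler_sum => om _.
have [/constant_mapP[x Ax]|_] := boolP (constant_map _).
  rewrite mulr0 hamming_eq0 // => v /=; rewrite !copy_stepE.
  rewrite Ax; apply/esym; rewrite (@eq_ancestor _ _ (extend om)) // => i ik.
  by rewrite extend_swap ?(ltn_trans ik (ltnW kN)) // !ifN //; apply/eqP; lia.
by rewrite mulr1 hamming_le.
Qed.

Lemma influence_late M j : (M <= j)%N -> (j.+1 < N.+1)%N -> influence M j = 0.
Proof.
move=> Mj jN; rewrite /influence big1 // => om _; apply: hamming_eq0.
apply: eq_ancestor => i iM; rewrite extend_swap //.
  by rewrite !ifN //; apply/eqP; lia.
by lia.
Qed.

Lemma influence_ge0 M j : 0 <= influence M j.
Proof. by apply: sumr_ge0 => om _; exact: hamming_ge0. Qed.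

Definition displacement (M : nat) (s : {perm 'I_N.+1}) : R :=
  \sum_om hamming R (ancestor (extend om) M) (ancestor (extend (permute s om)) M).

Definition swaps_perm (js : seq nat) : {perm 'I_N.+1} :=
  foldr (fun j s => swap_perm j * s)%g 1%g js.

Lemma sum_permute (F : seqs -> R) s : \sum_om F (permute s om) = \sum_om F om.
Proof. by rewrite [RHS](reindex_inj (@permute_inj s)). Qed.

(** Triangle inequality along the successive swaps. Each intermediate sequence is again uniform,
    since permuting coordinates is a bijection. *)
Lemma displacement_swaps M js :
  displacement M (swaps_perm js) <= \sum_(j <- js) influence M j.
Proof.
elim: js => [|j js IH] /=.
  rewrite big_nil /displacement big1 // => om _; apply: hamming_eq0.
  by apply: eq_ancestor => i _; rewrite /extend ffunE perm1.
rewrite big_cons addrC; apply: le_trans (lerD IH (lexx _)).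
rewrite /influence -(sum_permute _ (swaps_perm js)) -big_split /=.
apply: ler_sum => om _; rewrite permuteM; exact: hamming_triangle.
Qed.

(** For constant maps the last clause says that the roots differ. Asking for a difference at every
    vertex makes it cost the full Hamming distance [#|G|]. *)
Definition roots_differ (M : nat) (s : {perm 'I_N.+1}) (om : seqs) : bool :=
  [|| ~~ constant_map (ancestor (extend om) M),
      ~~ constant_map (ancestor (extend (permute s om)) M) |
      [forall v, ancestor (extend om) M v != ancestor (extend (permute s om)) M v]].

(** The factor 2 accounts for the original and the permuted sequence, which have the same law; the
    last term is a Markov bound. *)
Lemma sum_roots_differ M s : (0 < #|G|)%N ->
  \sum_om (roots_differ M s om)%:R <=
  2 * \sum_om (~~ constant_map (ancestor (extend om) M))%:R
   + displacement M s / #|G|%:R.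
Proof.
move=> n0; rewrite mulr_natl mulr2n.
rewrite -{2}(sum_permute (fun om => (~~ constant_map (ancestor (extend om) M))%:R) s).
rewrite mulr_suml -!big_split /=.
apply: ler_sum => om _; rewrite /roots_differ.
set c := constant_map _; set c' := constant_map _.
have h0 := hamming_ge0 R (ancestor (extend om) M) (ancestor (extend (permute s om)) M).
have n0' : 0 < #|G|%:R :> R by rewrite ltr0n.
have q0 := divr_ge0 h0 (ltW n0').
case: c => /=; last by rewrite -addrA lerDl addr_ge0.
case: c' => /=; last by rewrite add0r lerDl.
case: forallP => [H|_]; last by rewrite !add0r.
rewrite !add0r ler_pdivlMr // mul1r -sum1_card natr_sum.
by apply: ler_sum => v _; rewrite H.
Qed.

End dart_sequences.

(** * Interchange paths as products of adjacent swaps *)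

Section swaps.

Definition swapn (j k : nat) : nat :=
  if k == j then j.+1 else if k == j.+1 then j else k.

(** The head of the list acts first. For interchange paths the list runs backwards in time, with the
    latest rings at its head. *)
Definition swaps (js : seq nat) : nat -> nat :=
  foldr (fun j f => f \o swapn j) id js.

Lemma swapnK j : involutive (swapn j).
Proof.
move=> k; rewrite /swapn; case: (eqVneq k j) => [->|kj].
  by rewrite gtn_eqF // eqxx.
case: (eqVneq k j.+1) => [->|kj']; first by rewrite eqxx.
by rewrite (negbTE kj) (negbTE kj').
Qed.

Lemma swaps_inj js : injective (swaps js).
Proof. by elim: js => //= j js IH; apply: inj_comp => //; exact: inv_inj (@swapnK j). Qed.

Lemma swaps_cat js js' k : swaps (js ++ js') k = swaps js' (swaps js k).
Proof. by elim: js k => //= j js IH k. Qed.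

Lemma swapn_le l j k : (j < l)%N -> (k <= l)%N -> (swapn j k <= l)%N.
Proof. by move=> ? ?; rewrite /swapn; case: eqP => _; [lia|case: eqP => _; lia]. Qed.

Lemma swaps_perm_val N js k : all (fun j => j < N)%N js -> (k <= N)%N ->
  val (swaps_perm N js (inord k)) = swaps js k.
Proof.
elim: js k => [|j js IH] k /=; first by move=> _ kN; rewrite perm1 inordK.
move=> /andP[jN jsN] kN.
suff E : swap_perm N j (inord k) = inord (swapn j k).
  by rewrite permM E IH ?swapn_le.
have inord_eq i : (i <= N)%N -> (inord i == inord k :> 'I_N.+1) = (i == k).
  move=> iN; apply/eqP/eqP => [/(congr1 val)|-> //].
  by rewrite /= !inordK.
rewrite /swapn /swap_perm.
case: (eqVneq k j) => [->|kj]; first by rewrite tpermL.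
case: (eqVneq k j.+1) => [->|kj']; first by rewrite tpermR.
by rewrite tpermD // inord_eq // 1?eq_sym // ltnW.
Qed.

(** Describes clocks ringing at the same instant: no two of them are adjacent, so their swaps act on
    disjoint pairs and the order is irrelevant. *)
Lemma swaps_disjoint js k : uniq js -> (forall j, j \in js -> j.+1 \notin js) ->
  swaps js k = if k \in js then k.+1
    else if k is k'.+1 then (if k' \in js then k' else k) else k.
Proof.
elim: js k => [|j js IH] k /=; first by case: k.
move=> /andP[jjs ujs] H.
have H' i : i \in js -> i.+1 \notin js.
  by move=> ijs; have := H i; rewrite !inE ijs orbT negb_or => /(_ isT) /andP[].
have jS : j.+1 \notin js.
  by have := H j; rewrite !inE eqxx negb_or => /(_ isT) /andP[].
have Sj i : i.+1 = j -> i \notin js.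
  move=> ij; apply/negP => ijs; have := H i.
  by rewrite !inE ijs orbT ij eqxx => /(_ isT).
rewrite IH // !inE /swapn.
case: (eqVneq k j) => [->|kj].
  by rewrite (negbTE jS) (negbTE jjs).
case: (eqVneq k j.+1) => [->|kj'].
  rewrite (negbTE jjs) (negbTE jS) inE eqxx /=.
  by case: j {IH jjs H jS kj} Sj => // i /(_ i erefl) /negbTE ->.
rewrite /=; case: ifP => // _; case: k kj kj' => // k kj kj'.
by rewrite inE; case: (eqVneq k j) kj' => // ->; rewrite eqxx.
Qed.

End swaps.

Section path.
Variable R : realType.

Lemma seq_maximum (s : seq R) : s != [::] ->
  exists2 u, u \in s & forall x, x \in s -> x <= u.
Proof.
elim: s => // x [|y s] IH _; first by exists x; rewrite ?inE // => y; rewrite inE => /eqP ->.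
have [//|u us uM] := IH.
case: (leP x u) => xu.
  exists u; first by rewrite inE us orbT.
  by move=> w; rewrite inE => /predU1P[->//|]; exact: uM.
exists x; first by rewrite inE eqxx.
move=> w; rewrite inE => /predU1P[->//|/uM wu]; exact: le_trans wu (ltW xu).
Qed.

Lemma count_lt (T : eqType) (P Q : pred T) (s : seq T) (u : T) :
  subpred P Q -> u \in s -> Q u -> ~~ P u -> (count P s < count Q s)%N.
Proof.
move=> PQ us Qu Pu; elim: s us => //= x s IH; rewrite inE => /predU1P[<-|/IH lt].
  by rewrite Qu (negbTE Pu) add0n add1n ltnS sub_count.
rewrite -addnS leq_add //; case Px: (P x) => //.
by rewrite PQ.
Qed.

(** The silent clock [l] isolates the sites up to [l], where the lists [ts] contain all ring times.
    The path is constant between these and makes disjoint swaps at each of them, so induction on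
    their number gives the product. *)
Lemma interchange_path_swaps (ring : nat -> R -> Prop) (z : R -> nat -> nat)
    (t : R) (l : nat) (ts : nat -> seq R) :
  interchange_path ring z -> 0 <= t ->
  (forall u, 0 < u -> u <= t -> ~ ring l u) ->
  (forall j u, (j < l)%N -> 0 < u -> u <= t -> ring j u -> u \in ts j) ->
  exists js : seq nat, [/\ all (fun j => j < l)%N js,
    forall k, (k <= l)%N -> z t k = swaps js k &
    forall j, (count_mem j js <= count (fun u => (u <= t)%R) (ts j))%N].
Proof.
move=> [z0 zconst zswap] t0 silent tsP.
pose times := flatten [seq ts j | j <- iota 0 l].
have timesP j u : (j < l)%N -> 0 < u -> u <= t -> ring j u -> u \in times.
  move=> jl u0 ut r; apply/flatten_mapP; exists j; last exact: tsP.
  by rewrite mem_iota.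
(* For the site [l] itself, one of the two clocks touching it is the silent one. *)
have quiet k s u : (k <= l)%N -> 0 <= s -> s <= u -> u <= t ->
    (forall j v, (j < l)%N -> j = k \/ j.+1 = k -> s < v -> v <= u -> v \in times ->
       ring j v -> False) ->
    z u k = z s k.
  move=> kl s0 su ut H; apply: zconst => // j v jk sv vu r.
  have v0 : 0 < v by apply: le_lt_trans sv.
  have vt : v <= t by apply: le_trans ut.
  case: (ltngtP j l) => jl; last by subst j; exact: (silent v).
    by apply: (H j v) => //; exact: timesP r.
  by case: jk => jk; lia.
suff main n s : 0 <= s -> s <= t ->
    (count (fun u => (0 < u <= s)%R) times <= n)%N ->
    exists js : seq nat, [/\ all (fun j => j < l)%N js,
      forall k, (k <= l)%N -> z s k = swaps js k &
      forall j, (count_mem j js <= count (fun u => (u <= s)%R) (ts j))%N].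
  exact: (main _ t t0 (lexx t) (leqnn _)).
elim: n s => [|n IH] s s0 st cs.
  exists [::]; split=> // k kl; rewrite /= -[RHS]z0; apply: quiet => //.
  move=> j v _ _ v0 vs vtimes _.
  move: cs; rewrite leqn0 -leqn0 leqNgt -has_count => /hasP; apply.
  by exists v => //; rewrite v0 vs.
pose before := [seq u <- times | 0 < u <= s].
case: (eqVneq before [::]) => [b0|bn].
  apply: IH => //; by rewrite -size_filter -/before b0.
have [u ub umax] := seq_maximum bn.
have /andP[/andP[u0 us] utimes] : (0 < u <= s) && (u \in times) by rewrite mem_filter in ub.
have ut : u <= t := le_trans us st.
have zsu k : (k <= l)%N -> z s k = z u k.
  move=> kl; apply: quiet => //; first exact: ltW.
  move=> j v jl _ uv vs vtimes _.
  have : v \in before by rewrite mem_filter vtimes vs (lt_trans u0 uv).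
  by move=> /umax; rewrite leNgt uv.
(* [sw j] starts a window before [u] on which the swap clause for clock [j] holds; it defaults to 0
   if [j] does not ring at [u]. *)
have /choice[sw swP] : forall j, exists w, 0 <= w < u /\
   (ring j u -> forall v, w <= v -> v < u -> z u j = z v j.+1 /\ z u j.+1 = z v j).
  move=> j; case: (pselect (ring j u)) => [r|nr].
    by have [w [w0 wu H]] := zswap j u u0 r; exists w; rewrite w0 wu.
  by exists 0; rewrite lexx u0.
(* Their maximum [v] lies before [u], inside all the windows, and no listed time falls strictly
   between [v] and [u]. All swaps at [u] can thus be read off from [z v]. *)
pose marks := 0 :: [seq w <- before | w < u] ++ [seq sw j | j <- iota 0 l].
have [v vm vmax] : exists2 v, v \in marks & forall x, x \in marks -> x <= v.
  exact: seq_maximum.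
have vu : v < u.
  move: vm; rewrite inE mem_cat => /or3P[/eqP->//||].
    by rewrite mem_filter => /andP[].
  by case/mapP => j _ ->; have [/andP[]] := swP j.
have v0 : 0 <= v by apply: vmax; rewrite inE eqxx.
have swv j : (j < l)%N -> sw j <= v.
  move=> jl; apply: vmax; rewrite inE mem_cat; apply/or3P/Or33/mapP.
  by exists j; rewrite ?mem_iota.
have gap w : w \in times -> v < w -> w <= u -> w = u.
  move=> wt vw wu; apply/eqP; rewrite eq_le wu /= leNgt; apply/negP => wu'.
  have : w \in marks.
    rewrite inE mem_cat mem_filter wu' mem_filter wt (le_lt_trans v0 vw).
    by rewrite (le_trans wu us) orbT.
  by move=> /vmax; rewrite leNgt vw.
have [js [jsl zv jsc]] : exists js : seq nat, [/\ all (fun j => j < l)%N js,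
      forall k, (k <= l)%N -> z v k = swaps js k &
      forall j, (count_mem j js <= count (fun u => (u <= v)%R) (ts j))%N].
  apply: IH => //; first exact: ltW (lt_le_trans vu ut).
  rewrite -ltnS; apply: leq_trans cs.
  apply: (@count_lt _ _ _ _ u) => //; last by rewrite u0 leNgt vu.
    by move=> w /= /andP[-> wv]; exact: le_trans wv (le_trans (ltW vu) us).
  by rewrite u0 us.
pose Js := [seq j <- iota 0 l | `[< ring j u >]].
have JsP j : j \in Js = (j < l)%N && `[< ring j u >].
  by rewrite mem_filter mem_iota add0n /= andbC.
have zring j : j \in Js -> z u j = z v j.+1 /\ z u j.+1 = z v j.
  by rewrite JsP => /andP[jl /asboolP r]; apply: (swP j).2 => //; exact: swv.
have zrest k : (k <= l)%N -> k \notin Js -> (forall j, j.+1 = k -> j \notin Js) ->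
    z u k = z v k.
  move=> kl kJ kJ'; apply: quiet => //; first exact: ltW.
  move=> j w jl jk vw wu wt r; have wE := gap w wt vw wu; subst w.
  have jJ : j \in Js by rewrite JsP jl; apply/asboolP.
  by case: jk => jk; [subst j; rewrite jJ in kJ|have := kJ' j jk; rewrite jJ].
(* Adjacent clocks cannot ring together, since then [z v] would take the same
   value at [j] and at [j.+2]. *)
have Jsep j : j \in Js -> j.+1 \notin Js.
  move=> jJ; apply/negP => jJ'.
  have [_ e1] := zring _ jJ; have [e2 _] := zring _ jJ'.
  move: jJ'; rewrite JsP => /andP[jl _].
  have : z v j = z v j.+2 by rewrite -e1 -e2.
  rewrite (zv _ jl) (zv _ (ltnW (ltnW jl))) => /swaps_inj /eqP.
  by rewrite ltn_eqF // ltnW.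
exists (Js ++ js); split.
- rewrite all_cat jsl andbT; apply/allP => j; rewrite JsP => /andP[] //.
- move=> k kl; rewrite zsu // swaps_cat (@swaps_disjoint Js) ?filter_uniq ?iota_uniq //.
  case: ifP => kJ.
    have [-> _] := zring _ kJ; apply: zv.
    by move: kJ; rewrite JsP => /andP[].
  case: k kl kJ => [|k] kl kJ; first by rewrite zrest ?kJ // zv.
  case: ifP => kJ'; first by have [_ ->] := zring _ kJ'; rewrite zv // ltnW.
  by rewrite zrest ?kJ ?zv // => j [->]; rewrite kJ'.
(* A clock ringing at [u] adds one swap to the list, paid for by the listed time [u], which exceeds
   [v]. *)
- move=> j; rewrite count_cat.
  have -> : count_mem j Js = (j \in Js).
    by rewrite count_uniq_mem // filter_uniq // iota_uniq.
  have vs_sub : subpred (fun w => w <= v) (fun w => w <= s).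
    by move=> w wv; exact: le_trans wv (le_trans (ltW vu) us).
  rewrite JsP; case: andP => [[jl /asboolP r]|_]; last first.
    by rewrite add0n (leq_trans (jsc j)) // sub_count.
  rewrite add1n (leq_ltn_trans (jsc j)) // (@count_lt _ _ _ _ u) //.
    exact: tsP.
  by rewrite leNgt vu.
Qed.

End path.

(** * Discrete random variables *)

Section sigma_algebra_closure.
Variables (T : Type) (S : set (set T)).
Hypothesis S_sigma : sigma_algebra setT S.

Lemma sigma_setC A : S A -> S (~` A).
Proof. by case: S_sigma => _ SC _ SA; rewrite -setTD; exact: SC. Qed.

(** Stated for an arbitrary sigma-algebra, so as to serve both measurability and membership in the
    generated sigma-algebras of the independence hypotheses. *)
Lemma sigma_exists (I : countType) (F : I -> set T) :
  (forall i, S (F i)) -> S [set w | exists i, F i w].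
Proof.
case: S_sigma => S0 _ SU SF.
have -> : [set w | exists i, F i w] =
    \bigcup_n (if choice.unpickle n is Some i then F i else set0).
  apply/seteqP; split=> w /=.
    by case=> i Fi; exists (choice.pickle i) => //; rewrite choice.pickleK.
  by case=> n _; case: choice.unpickle => // i Fi; exists i.
by apply: SU => n; case: choice.unpickle.
Qed.

Lemma sigma_forall (I : countType) (F : I -> set T) :
  (forall i, S (F i)) -> S [set w | forall i, F i w].
Proof.
move=> SF.
have -> : [set w | forall i, F i w] = ~` [set w | exists i, (~` F i) w].
  apply/seteqP; split=> w /= H; first by case=> i; apply.
  by move=> i; apply: contrapT => nF; apply: H; exists i.
by apply: sigma_setC; apply: sigma_exists => i; exact: sigma_setC.
Qed.

Lemma sigma_fibers (I : countType) (X : T -> I) (Q : set I) :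
  (forall i, S [set w | X w = i]) -> S (X @^-1` Q).
Proof.
move=> SX.
have -> : X @^-1` Q = [set w | exists i, ([set w | X w = i] `&` [set w | Q i]) w].
  by apply/seteqP; split=> w /=; [exists (X w)|case=> i [->]].
apply: sigma_exists => i; case: (pselect (Q i)) => q.
  by rewrite (_ : [set w | Q i] = setT) ?setIT // -subTset => w _.
rewrite (_ : [set w | Q i] = set0) ?setI0; first by case: S_sigma.
by rewrite -subset0 => w /q.
Qed.

Lemma sigma_fibers_ffun (I : finType) (A : countType) (X : I -> T -> A) :
  (forall i a, S [set w | X i w = a]) ->
  forall f, S [set w | [ffun i => X i w] = f].
Proof.
move=> SX f.
have -> : [set w | [ffun i => X i w] = f] = [set w | forall i, [set w | X i w = f i] w].
  apply/seteqP; split=> w /= H; first by move=> i; rewrite -H ffunE.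
  by apply/ffunP => i; rewrite ffunE.
by apply: sigma_forall => i; exact: SX.
Qed.

End sigma_algebra_closure.

(** * Real-valued probabilities of discrete events *)

Section probability_reals.
Context (R : realType) d (T : measurableType d) (P : probability T R).

Definition prob (A : set T) : R := fine (P A).

Lemma probE A : measurable A -> P A = (prob A)%:E.
Proof. by move=> mA; rewrite /prob fineK // fin_num_measure. Qed.

Lemma prob_ge0 A : 0 <= prob A.
Proof. by rewrite fine_ge0. Qed.

Lemma prob_le A B : measurable A -> measurable B -> A `<=` B -> prob A <= prob B.
Proof.
move=> mA mB AB; rewrite -lee_fin -!probE //.
by apply: le_measure => //; rewrite inE.
Qed.

Lemma prob_le1 A : measurable A -> prob A <= 1.
Proof. by move=> mA; rewrite -lee_fin -probE // probability_le1. Qed.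

Lemma probU A B : measurable A -> measurable B -> A `&` B = set0 ->
  prob (A `|` B) = prob A + prob B.
Proof.
move=> mA mB AB; apply: EFin_inj; rewrite EFinD -!probE //; last exact: measurableU.
exact: measureU.
Qed.

Lemma probU_le A B : measurable A -> measurable B ->
  prob (A `|` B) <= prob A + prob B.
Proof.
move=> mA mB; rewrite -lee_fin EFinD -!probE //; last exact: measurableU.
exact: measureU2.
Qed.

Lemma prob_set0 : prob set0 = 0.
Proof. by rewrite /prob measure0. Qed.

Lemma prob_exists_le (I : finType) (F : I -> set T) :
  (forall i, measurable (F i)) ->
  prob [set w | exists i, F i w] <= \sum_i prob (F i).
Proof.
move=> mF.
have mS (s : seq I) : measurable [set w | exists2 i, i \in s & F i w].
  elim: s => [|i s IH].
    by rewrite (_ : mkset _ = set0) //; apply/seteqP; split=> w //= [].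
  rewrite (_ : mkset _ = F i `|` [set w | exists2 i, i \in s & F i w]).
    exact: measurableU.
  apply/seteqP; split=> w /=.
    by case=> j; rewrite inE => /predU1P[->|js] Fj; [left|right; exists j].
  case=> [Fi|[j js Fj]]; first by exists i => //; rewrite inE eqxx.
  by exists j => //; rewrite inE js orbT.
have -> : [set w | exists i, F i w] = [set w | exists2 i, i \in index_enum I & F i w].
  apply/seteqP; split=> w /= [i]; [move=> Fi|move=> _ Fi]; exists i => //.
  by rewrite mem_index_enum.
elim: (index_enum I) => [|i s IH].
  rewrite big_nil (_ : mkset _ = set0) ?prob_set0 //.
  by apply/seteqP; split=> w //= [].
rewrite big_cons; apply: le_trans (lerD (lexx _) IH).
apply: le_trans (probU_le _ (mS s)) => //.
apply: prob_le => //; first exact: measurableU.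
move=> w /= [j]; rewrite inE => /predU1P[->|js] Fj; first by left.
by right; exists j.
Qed.

Lemma prob_fibers (I : finType) (X : T -> I) (B : set T) (Q : pred I) :
  measurable B -> (forall i, measurable [set w | X w = i]) ->
  prob [set w | B w /\ Q (X w)] = \sum_(i | Q i) prob [set w | B w /\ X w = i].
Proof.
move=> mB mX.
have mXB i : measurable [set w | B w /\ X w = i] by exact: (measurableI _ _ mB (mX i)).
have mS (s : seq I) : measurable [set w | B w /\ X w \in s].
  apply: (measurableI _ _ mB).
  exact: (sigma_fibers (sigma_algebra_measurable T) (fun i => i \in s) mX).
have -> : [set w | B w /\ Q (X w)] =
    [set w | B w /\ X w \in [seq i <- index_enum I | Q i]].
  by apply/seteqP; split=> w /= []; rewrite mem_filter mem_index_enum andbT.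
rewrite -big_filter; have := filter_uniq Q (index_enum_uniq I).
elim: [seq i <- index_enum I | Q i] => [|i s IH] /=.
  move=> _; rewrite big_nil (_ : mkset _ = set0) ?prob_set0 //.
  by apply/seteqP; split=> w //= [].
move=> /andP[ins us]; rewrite big_cons -IH // -probU //.
  congr prob; apply/seteqP; split=> w /=.
    by case=> Bw; rewrite inE => /predU1P[<-|js]; [left|right].
  by case=> -[Bw]; rewrite inE => ->; rewrite ?eqxx ?orbT.
apply/seteqP; split=> w //= -[[_ Xi] [_ Xs]].
by move: ins; rewrite -Xi Xs.
Qed.

Lemma prob_independent (I J : finType) (X : T -> I) (Y : T -> J)
    (F1 F2 : set (set T)) (Q : I -> pred J) :
  independent P F1 F2 ->
  (forall i, measurable [set w | X w = i]) ->
  (forall j, measurable [set w | Y w = j]) ->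
  (forall i, F1 [set w | X w = i]) -> (forall j, F2 [set w | Y w = j]) ->
  prob [set w | Q (X w) (Y w)] =
  \sum_i prob [set w | X w = i] * \sum_(j | Q i j) prob [set w | Y w = j].
Proof.
move=> ind mX mY F1X F2Y.
have mXQ i : measurable [set w | Q i (Y w)].
  exact: (sigma_fibers (sigma_algebra_measurable T) (fun j => Q i j) mY).
have mQ : measurable [set w | Q (X w) (Y w)].
  rewrite (_ : mkset _ = [set w | exists i, ([set w | X w = i] `&` [set w | Q i (Y w)]) w]).
    by apply: (sigma_exists (sigma_algebra_measurable T)) => i; exact: measurableI.
  by apply/seteqP; split=> w /=; [exists (X w)|case=> i [->]].
have -> : [set w | Q (X w) (Y w)] = [set w | Q (X w) (Y w) /\ predT (X w)].
  by apply/seteqP; split=> w /=; [split|case].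
rewrite (prob_fibers (B := [set w | Q (X w) (Y w)])) //; apply: eq_bigr => i _.
have -> : [set w | Q (X w) (Y w) /\ X w = i] = [set w | X w = i /\ Q i (Y w)].
  by apply/seteqP; split=> w /= -[]; [move=> q <-|move=> <- q].
rewrite (prob_fibers (B := [set w | X w = i])) // mulr_sumr; apply: eq_bigr => j _.
apply: EFin_inj; rewrite EFinM -!probE //; last exact: (measurableI _ _ (mX i) (mY j)).
exact: (ind _ _ (F1X i) (F2Y j)).
Qed.

(** Monotonicity of expectation for finite nonnegative combinations of indicators; this is how a
    pathwise bound is averaged later. *)
Lemma prob_indic_le (I J : finType) (c : I -> R) (A : I -> set T)
    (c' : J -> R) (B : J -> set T) :
  (forall i, 0 <= c i) -> (forall j, 0 <= c' j) ->
  (forall i, measurable (A i)) -> (forall j, measurable (B j)) ->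
  (forall w, \sum_i c i * \1_(A i) w <= \sum_j c' j * \1_(B j) w) ->
  \sum_i c i * prob (A i) <= \sum_j c' j * prob (B j).
Proof.
move=> c0 c'0 mA mB H.
have E (K : finType) (e : K -> R) (C : K -> set T) : (forall k, 0 <= e k) ->
    (forall k, measurable (C k)) ->
    (\sum_k e k * prob (C k))%:E = (\int[P]_w (\sum_k e k * \1_(C k) w)%:E)%E.
  move=> e0 mC.
  under eq_integral do rewrite -sumEFin.
  rewrite ge0_integral_sum //; first last.
  - by move=> k w _; rewrite lee_fin mulr_ge0.
  - by move=> k; apply/measurable_EFinP; apply: measurable_funM => //; exact: measurable_indic.
  rewrite -sumEFin; apply: eq_bigr => k _.
  under eq_integral do rewrite EFinM.
  rewrite ge0_integralZl_EFin //; first by rewrite integral_indic // setIT EFinM -probE.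
  by apply/measurable_EFinP; exact: measurable_indic.
rewrite -lee_fin !E //; apply: ge0_le_integral => //.
- by move=> w _; rewrite lee_fin sumr_ge0 // => i _; rewrite mulr_ge0.
- apply/measurable_EFinP; apply: measurable_sum => i.
  by apply: measurable_funM => //; exact: measurable_indic.
- apply/measurable_EFinP; apply: measurable_sum => i.
  by apply: measurable_funM => //; exact: measurable_indic.
- by move=> w _; rewrite lee_fin.
Qed.

Lemma mutually_independent_seq (I : choiceType) (F : I -> set (set T))
    (s : seq I) (A : I -> set T) :
  mutually_independent P F -> uniq s -> (forall i, F i (A i)) ->
  (forall i, measurable (A i)) ->
  prob [set w | forall i, i \in s -> A i w] = \prod_(i <- s) prob (A i).
Proof.
move=> ind us FA mA.
have := ind (seq_fset tt s) A (fun i _ => FA i).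
have -> : \bigcap_(i in [set` seq_fset tt s]) A i = [set w | forall i, i \in s -> A i w].
  have sE i : (i \in seq_fset tt s) = (i \in s) by exact: seq_fsetE.
  apply/seteqP; split=> w H i; first by move=> si; apply: (H i); rewrite /mkset sE.
  by rewrite /mkset sE; exact: H.
rewrite (perm_big _ (seq_fset_perm _ _)) /= undup_id // => E.
apply: EFin_inj; rewrite -prodEFin /prob E.
rewrite fineK; first by apply: eq_bigr => i _; rewrite probE.
by rewrite (eq_bigr (fun i => (prob (A i))%:E)) ?prodEFin // => i _; rewrite probE.
Qed.

End probability_reals.

(** * Exponential clocks *)

Section clocks.
Context (R : realType) d (T : measurableType d) (P : probability T R).

(** The density vanishes on the negatives and is at most 1 elsewhere. *)
Lemma exponential_prob_le (t : R) : 0 <= t ->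
  (exponential_prob 1 `]-oo, t] <= t%:E)%E.
Proof.
move=> t0; rewrite /exponential_prob.
apply: (@le_trans _ _
  (\int[lebesgue_measure]_(x in `]-oo, t]) (\1_(`[0, t] : set R) x)%:E)%E).
  apply: ge0_le_integral => //.
  - by move=> x _; rewrite lee_fin exponential_pdf_ge0.
  - apply/measurable_EFinP; apply: measurable_funTS.
    exact: measurable_exponential_pdf.
  - by apply/measurable_EFinP; exact: measurable_indic.
  move=> x /=; rewrite in_itv /= => xt; rewrite lee_fin.
  have [x0|x0] := ltP x 0; first by rewrite lt0_exponential_pdf.
  rewrite exponential_pdfE // mul1r mulN1r indicE mem_set ?expR_le1 ?oppr_le0 //.
  by rewrite /= in_itv /= x0.
rewrite integral_indic //= (_ : _ `&` _ = `[0, t]%classic); last first.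
  by apply: setIidl => x /=; rewrite !in_itv /= => /andP[].
by rewrite lebesgue_measure_itv /= lte_fin; case: ltP; rewrite ?oppr0 ?adde0 ?lee_fin.
Qed.

Variable tau : nat -> nat -> {RV P >-> R}.
Hypothesis tau_clocks : rate_one_clocks tau.

Lemma measurable_clock j l t : measurable [set w | tau j l w <= t].
Proof.
have -> : [set w | tau j l w <= t] = tau j l @^-1` `]-oo, t].
  by apply/seteqP; split=> w /=; rewrite in_itv.
exact: measurable_funPTI.
Qed.

Lemma prob_clock j l t : 0 <= t -> prob P [set w | tau j l w <= t] <= t.
Proof.
move=> t0; rewrite -lee_fin -probE; last exact: measurable_clock.
apply: le_trans (exponential_prob_le t0).
rewrite -(tau_clocks.1 j l) // /distribution /pushforward.
Qed.

Lemma prob_clocks (s : seq (nat * nat)) t : 0 <= t -> uniq s ->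
  prob P [set w | forall ji, ji \in s -> tau ji.1 ji.2 w <= t] <= t ^+ size s.
Proof.
move=> t0 us.
rewrite (mutually_independent_seq (A := fun ji : nat * nat => [set w | tau ji.1 ji.2 w <= t])
  tau_clocks.2 us); first last.
- by move=> ji; exact: measurable_clock.
- move=> [j l] /=; exists `]-oo, t]%classic => //.
  by rewrite setTI; apply/seteqP; split=> w /=; rewrite in_itv.
elim: s {us} => [|ji s IH]; first by rewrite big_nil.
rewrite big_cons exprS ler_pM ?prob_clock ?prob_ge0 //.
by apply: prodr_ge0 => *; exact: prob_ge0.
Qed.

(** With positive waiting times this contains the event that the ring of index [i] occurs by time
    [t], and it is an intersection of independent events. *)
Definition early j i t : set T := [set w | forall l, (l <= i)%N -> tau j l w <= t].

Lemma early_seq j i t :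
  early j i t = [set w | forall jl, jl \in [seq (j, l) | l <- iota 0 i.+1] ->
                         tau jl.1 jl.2 w <= t].
Proof.
apply/seteqP; split=> w H.
  by move=> jl /mapP[l]; rewrite mem_iota => /andP[_ li] ->; exact: H.
by move=> l li; apply: (H (j, l)); rewrite map_f // mem_iota.
Qed.

Lemma measurable_early j i t : measurable (early j i t).
Proof.
have -> : early j i t = [set w | forall l : 'I_i.+1, [set w | tau j l w <= t] w].
  apply/seteqP; split=> w /= H l; first by apply: H; rewrite -ltnS.
  by rewrite -ltnS => li; exact: (H (Ordinal li)).
apply: (sigma_forall (sigma_algebra_measurable T)) => l.
exact: measurable_clock.
Qed.

Lemma prob_early j i t : 0 <= t -> prob P (early j i t) <= t ^+ i.+1.
Proof.
move=> t0; rewrite early_seq.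
apply: le_trans (prob_clocks t0 _) _; last by rewrite size_map size_iota.
by rewrite map_inj_uniq ?iota_uniq // => ? ? [].
Qed.

(** A clock whose first waiting time exceeds [t] is silent; among [L] independent clocks the absence
    of such a clock is exponentially unlikely for [t < 1]. *)
Lemma prob_no_silent M L t : 0 <= t ->
  prob P [set w | forall j, (M <= j < M + L)%N -> tau j 0 w <= t] <= t ^+ L.
Proof.
move=> t0; have -> : [set w | forall j, (M <= j < M + L)%N -> tau j 0 w <= t] =
  [set w | forall jl, jl \in [seq (j, 0%N) | j <- iota M L] -> tau jl.1 jl.2 w <= t].
  apply/seteqP; split=> w H.
    by move=> jl /mapP[j]; rewrite mem_iota => ? ->; exact: H.
  by move=> j jM; apply: (H (j, 0%N)); rewrite map_f // mem_iota.
apply: le_trans (prob_clocks t0 _) _; last by rewrite size_map size_iota.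
by rewrite map_inj_uniq ?iota_uniq // => ? ? [].
Qed.

End clocks.

(** * The voter model with interchange noise *)

Lemma sigma_family_fiber (T E I : Type) (D : set I) (X : I -> T -> E) i a :
  D i -> sigma_family D X [set w | X i w = a].
Proof.
move=> Di; apply: sub_sigma_algebra; exists i => //.
by exists [set a] => //; rewrite setTI.
Qed.

(** * Measurability of the outcome *)

Section outcome_measurability.
Context d (T : measurableType d) (G : sgraph).
Variables (eta0 : G -> T -> bool) (omega : nat -> T -> dart G).
Hypothesis eta0_fiber : forall x b, measurable [set w | eta0 x w = b].
Hypothesis omega_fiber : forall k a, measurable [set w | omega k w = a].
Local Notation sigmaT := (sigma_algebra_measurable T).

Lemma measurable_ancestor k z y :
  measurable [set w | ancestor (fun k => omega k w) k z = y].
Proof.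
elim: k z => [|k IH] z /=.
  have [->|zy] := eqVneq z y.
    by rewrite (_ : mkset _ = setT) //; apply/seteqP; split.
  rewrite (_ : mkset _ = set0) //; apply/seteqP; split=> w //= zy'.
  by rewrite zy' eqxx in zy.
rewrite (_ : mkset _ = [set w | exists a, ([set w | omega k w = a] `&`
   [set w | ancestor (fun k => omega k w) k (if z == (val a).2 then (val a).1 else z) = y]) w]).
  by apply: (sigma_exists sigmaT) => a; apply: measurableI.
apply/seteqP; split=> w; rewrite /mkset copy_stepE; first by exists (omega k w).
by case=> a [/= <-].
Qed.

Lemma measurable_voter k x :
  measurable [set w | voter (fun x => eta0 x w) (fun k => omega k w) k x = true].
Proof.
rewrite (_ : mkset _ = [set w | exists y, ([set w | ancestor (fun k => omega k w) k x = y]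
   `&` [set w | eta0 y w = true]) w]).
  apply: (sigma_exists sigmaT) => y; apply: measurableI => //.
  exact: measurable_ancestor.
apply/seteqP; split=> w; rewrite /mkset voterE; last by case=> y [/= ->].
by move=> H; eexists; split; [reflexivity|].
Qed.

Lemma measurable_outcome b : measurable [set w | outcome eta0 omega w = b].
Proof.
have m1 : measurable [set w | outcome eta0 omega w = true].
  rewrite (_ : mkset _ = [set w | exists K, [set w | forall k, [set w | forall x,
    [set w | voter (fun x => eta0 x w) (fun k => omega k w) (K + k)%N x = true] w] w] w]).
    apply: (sigma_exists sigmaT) => K; apply: (sigma_forall sigmaT) => k.
    by apply: (sigma_forall sigmaT) => x; exact: measurable_voter.
  apply/seteqP; split=> w; rewrite /mkset /outcome /consensus.
    by move=> /asboolP[K H]; exists K => k x; apply: H; rewrite leq_addr.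
  move=> [K H]; apply/asboolP; exists K => k Kk x.
  by have := H (k - K)%N x; rewrite subnKC.
case: b => //.
rewrite (_ : mkset _ = ~` [set w | outcome eta0 omega w = true]); first exact: measurableC.
apply/seteqP; split=> w /=; first by move=> ->.
by case: outcome.
Qed.

End outcome_measurability.

Lemma sum_geometric (R : realType) (t : R) K : 0 <= t -> t <= 1 / 2 ->
  \sum_(i < K) t ^+ i.+1 <= 2 * t.
Proof.
move=> t0 t1.
(* The added remainder makes the induction close, because [2 * t <= 1]. *)
suff : \sum_(i < K) t ^+ i.+1 + 2 * t ^+ K.+1 <= 2 * t.
  by have := exprn_ge0 K.+1 t0; lra.
elim: K => [|K IH]; first by rewrite big_ord0 add0r expr1.
rewrite big_ord_recr /=; apply: le_trans IH.
have := exprn_ge0 K.+1 t0; rewrite [t ^+ K.+2]exprS => tK.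
by have : t * t ^+ K.+1 <= 1 / 2 * t ^+ K.+1 by [rewrite ler_wpM2r|]; lra.
Qed.

(** * Laws of the darts and of the outcome *)

Section model.
Context (R : realType) (p : R) (G : sgraph) d (T : measurableType d)
  (P : probability T R).
Variables (eta0 : G -> T -> bool) (omega : nat -> T -> dart G)
  (zeta : R -> nat -> T -> nat).
Hypothesis model : voter_interchange_model p P eta0 omega zeta.
Local Notation sigmaT := (sigma_algebra_measurable T).
Local Notation m := (#|{: dart G}|%:R : R).

Lemma measurable_eta0 x b : measurable [set w | eta0 x w = b].
Proof.
have mb : measurable [set b] by [].
by have := eta0_measurable (vim_eta0 model) x measurableT mb; rewrite setTI.
Qed.

Lemma measurable_omega k a : measurable [set w | omega k w = a].
Proof. exact: omega_measurable (vim_omega model) k a. Qed.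

Lemma measurable_zeta t k a : 0 <= t -> measurable [set w | zeta t k w = a].
Proof.
move=> t0; have ma : measurable [set a] by [].
by have := (vim_zeta model).1 t k t0 measurableT _ ma; rewrite setTI.
Qed.

Lemma measurable_noisy t k a : 0 <= t ->
  measurable [set w | noisy omega zeta t k w = a].
Proof.
move=> t0; rewrite (_ : mkset _ = [set w | exists j, ([set w | zeta t k w = j] `&`
   [set w | omega j w = a]) w]).
  apply: (sigma_exists sigmaT) => j; apply: measurableI; first exact: measurable_zeta.
  exact: measurable_omega.
apply/seteqP; split=> w; rewrite /mkset /noisy; last by case=> j [/= ->].
by move=> <-; eexists; split; reflexivity.
Qed.

Section finite_horizon.
Variable N : nat.
Local Notation seqs := {ffun 'I_N.+1 -> dart G}.

Definition darts_upto (w : T) : seqs := [ffun i : 'I_N.+1 => omega i w].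

Lemma measurable_darts_upto om : measurable [set w | darts_upto w = om].
Proof.
apply: (sigma_fibers_ffun sigmaT (X := fun (i : 'I_N.+1) w => omega i w)).
by move=> i a; exact: measurable_omega.
Qed.

Lemma sigma_omega_darts om : sigma_family setT omega [set w | darts_upto w = om].
Proof.
apply: (sigma_fibers_ffun (smallest_sigma_algebra _ _)
  (X := fun (i : 'I_N.+1) w => omega i w)).
by move=> i a; exact: sigma_family_fiber.
Qed.

Lemma sigma_eta_omega_darts om :
  <<s sigma_family setT eta0 `|` sigma_family setT omega >> [set w | darts_upto w = om].
Proof. by apply: sub_sigma_algebra; right; exact: sigma_omega_darts. Qed.

Lemma prob_darts_upto om : prob P [set w | darts_upto w = om] = #|{: seqs}|%:R^-1.
Proof.
have -> : [set w | darts_upto w = om] =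
   [set w | forall i, i \in iota 0 N.+1 -> [set w | omega i w = extend om i] w].
  apply/seteqP; split=> w; rewrite /mkset.
    move=> E i; rewrite mem_iota => /andP[_ iN].
    by rewrite -E /extend ffunE inordK.
  move=> H; apply/ffunP => i; rewrite ffunE H ?mem_iota ?ltn_ord //.
  by rewrite /extend inord_val.
rewrite (mutually_independent_seq (omega_indep (vim_omega model))) ?iota_uniq //; first last.
- by move=> i; exact: measurable_omega.
- by move=> i; exists [set extend om i] => //; rewrite setTI.
rewrite (eq_bigr (fun=> m^-1)) => [|i _]; last first.
  by apply: EFin_inj; rewrite -probE ?(omega_law (vim_omega model)) //; exact: measurable_omega.
by rewrite big_const_seq count_predT size_iota iter_mulr_1 card_ffun card_ord natrX exprVn.
Qed.

Lemma prob_darts_pred (Q : pred seqs) :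
  prob P [set w | Q (darts_upto w)] = (\sum_om (Q om)%:R) / #|{: seqs}|%:R.
Proof.
have -> : [set w | Q (darts_upto w)] = [set w | setT w /\ Q (darts_upto w)].
  by apply/seteqP; split=> w //= [].
rewrite prob_fibers //; last exact: measurable_darts_upto.
rewrite mulr_suml big_mkcond; apply: eq_bigr => om _.
have -> : [set w | setT w /\ darts_upto w = om] = [set w | darts_upto w = om].
  by apply/seteqP; split=> w //= [].
by rewrite prob_darts_upto; case: (Q om); rewrite ?mul1r ?mul0r.
Qed.

Lemma measurable_darts_pred (Q : pred seqs) : measurable [set w | Q (darts_upto w)].
Proof. exact: (sigma_fibers sigmaT (fun om => Q om) measurable_darts_upto). Qed.

(** For [M <= N.+1] this is the probability that the lineages have not all coalesced after [M]
    steps. *)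
Definition nonconstant (M : nat) : R :=
  (\sum_(om : seqs) (~~ constant_map (ancestor (extend om) M))%:R) / #|{: seqs}|%:R.

Lemma extend_darts_upto w i : (i <= N)%N -> extend (darts_upto w) i = omega i w.
Proof. by move=> iN; rewrite /extend ffunE inordK. Qed.

Definition opinions (w : T) : {ffun G -> bool} := [ffun x => eta0 x w].

Lemma measurable_opinions h : measurable [set w | opinions w = h].
Proof. by apply: (sigma_fibers_ffun sigmaT) => x b; exact: measurable_eta0. Qed.

Lemma prob_opinion x : \sum_(h : {ffun G -> bool} | h x) prob P [set w | opinions w = h] = p.
Proof.
transitivity (prob P [set w | eta0 x w = true]); last first.
  by apply: EFin_inj; rewrite -probE ?(eta0_law (vim_eta0 model)) //; exact: measurable_eta0.
pose at_x (h : {ffun G -> bool}) := h x.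
have -> : [set w | eta0 x w = true] = [set w | setT w /\ at_x (opinions w)].
  by apply/seteqP; split=> w /=; rewrite /at_x ffunE; [split|case].
rewrite (prob_fibers P at_x measurableT measurable_opinions).
apply: eq_bigr => h _; congr prob.
by apply/seteqP; split=> w //= [].
Qed.

(** After coalescence the outcome is the initial opinion of the root, and the root is a function of
    the darts, which are independent of the opinions. *)
Lemma prob_outcome_le (x0 : G) M : (M <= N.+1)%N ->
  `|prob P [set w | outcome eta0 omega w = true] - p| <= 2 * nonconstant M.
Proof.
move=> MN.
pose nc w := ~~ constant_map (ancestor (extend (darts_upto w)) M).
have c0 : 0 <= nonconstant M by rewrite divr_ge0 // sumr_ge0.
pose ncp (om : seqs) := ~~ constant_map (ancestor (extend om) M).
have ncE : prob P [set w | nc w] = nonconstant M by exact: (prob_darts_pred ncp).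
have mnc : measurable [set w | nc w] := measurable_darts_pred ncp.
pose Q (h : {ffun G -> bool}) (om : seqs) :=
  constant_map (ancestor (extend om) M) && h (ancestor (extend om) M x0).
pose Ev := [set w | Q (opinions w) (darts_upto w)].
have EvE : prob P Ev = p * (1 - nonconstant M).
  rewrite /Ev (prob_independent Q (vim_eta0_omega model)); first last.
  - exact: sigma_omega_darts.
  - move=> h; apply: (sigma_fibers_ffun (smallest_sigma_algebra _ _)).
    by move=> x b; exact: sigma_family_fiber.
  - exact: measurable_darts_upto.
  - exact: measurable_opinions.
  under eq_bigr do rewrite big_mkcond mulr_sumr.
  rewrite exchange_big /=.
  (* For fixed darts the root is a fixed vertex, whose opinion is 1 with probability [p]. *)
  transitivity (\sum_(om : seqs)
      p * ((constant_map (ancestor (extend om) M))%:R / #|{: seqs}|%:R)).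
    apply: eq_bigr => om _; rewrite prob_darts_upto -(prob_opinion (ancestor (extend om) M x0)).
    rewrite mulr_suml [RHS]big_mkcond; apply: eq_bigr => h _; rewrite /Q.
    by case: (constant_map _); case: (h _); rewrite /= ?mul1r ?mul0r ?mulr0.
  rewrite -mulr_sumr -mulr_suml; congr (_ * _).
  rewrite /nonconstant.
  (* Any sample point supplies a sequence of darts. *)
  have n0 : #|{: seqs}|%:R != 0 :> R.
    have := prob_darts_upto (darts_upto point); rewrite pnatr_eq0 -lt0n => _.
    by apply/card_gt0P; exists (darts_upto point).
  apply: (mulIf n0); rewrite mulrBl !divfK // mul1r.
  rewrite -[#|_|]sum1_card natr_sum -sumrB; apply: eq_bigr => om _.
  by case: constant_map; rewrite /= ?subr0 ?subrr.
have anc_w w : ancestor (extend (darts_upto w)) M =1 ancestor (fun k => omega k w) M.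
  by apply: eq_ancestor => i iM; apply: extend_darts_upto; rewrite -ltnS (leq_trans iM).
have outE w : ~~ nc w ->
    outcome eta0 omega w = (opinions w) (ancestor (extend (darts_upto w)) M x0).
  rewrite /nc negbK => /constant_mapP[y Hy].
  rewrite Hy ffunE /outcome; apply: (@consensus_ancestor _ _ _ M) => z.
  by rewrite -anc_w Hy.
have mEv : measurable Ev.
  rewrite (_ : Ev = [set w | exists h,
      ([set w | opinions w = h] `&` [set w | Q h (darts_upto w)]) w]).
    apply: (sigma_exists sigmaT) => h; apply: measurableI; first exact: measurable_opinions.
    exact: measurable_darts_pred.
  by apply/seteqP; split=> w; rewrite /Ev /mkset; [exists (opinions w)|case=> h [/= ->]].
have mout : measurable [set w | outcome eta0 omega w = true].
  by apply: measurable_outcome; [exact: measurable_eta0|exact: measurable_omega].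
have lo : prob P Ev <= prob P [set w | outcome eta0 omega w = true].
  apply: prob_le => // w /andP[cw hw]; rewrite /mkset outE //.
  by rewrite /nc negbK.
have hi : prob P [set w | outcome eta0 omega w = true] <= prob P Ev + nonconstant M.
  rewrite -ncE; apply: le_trans (probU_le P mEv mnc); apply: prob_le => //.
    exact: measurableU.
  move=> w; rewrite /mkset => o; case E : (nc w); first by right; rewrite /mkset E.
  left; rewrite /Ev /mkset /Q -(negbK (constant_map _)) -/(nc w) E /=.
  by rewrite -outE ?E.
have p1 : p <= 1.
  rewrite -lee_fin -(eta0_law (vim_eta0 model) x0) probability_le1 //.
  exact: measurable_eta0.
have p0 : 0 <= p.
  by rewrite -(prob_opinion x0) sumr_ge0 // => h _; exact: prob_ge0.
have pc : p * nonconstant M <= nonconstant M by rewrite ler_piMl.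
have pc0 : 0 <= p * nonconstant M by rewrite mulr_ge0.
rewrite EvE mulrBr mulr1 in lo hi.
by rewrite ler_norml; apply/andP; split; lra.
Qed.

End finite_horizon.
End model.

(** * Noise stability *)

Section averaged_influence.
Variables (R : realType) (G : sgraph) (N : nat).
Local Notation seqs := {ffun 'I_N.+1 -> dart G}.
Local Notation m := (#|{: dart G}|%:R : R).

Lemma card_seqs_gt0 : (0 < #|{: dart G}|)%N -> 0 < #|{: seqs}|%:R :> R.
Proof. by move=> m0; rewrite ltr0n card_ffun expn_gt0 m0. Qed.

Lemma nonconstant_ge0 M : 0 <= nonconstant R G N M.
Proof. by rewrite divr_ge0 // sumr_ge0. Qed.

Lemma nonconstant_le M (x0 : G) : (0 < #|{: dart G}|)%N -> graph_connected G ->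
  (0 < M)%N -> (M <= N.+1)%N ->
  nonconstant R G N M <= m * #|G|%:R ^+ 2 / M%:R.
Proof.
move=> m0 conn M0 MN; have s0 := card_seqs_gt0 m0.
rewrite /nonconstant ler_pdivrMr // mulrAC ler_pdivlMr ?ltr0n //.
by rewrite mulrC mulrAC; exact: sum_nonconstant.
Qed.

(** At horizon [M.+1] the swaps [j < M] are covered by [sum_influence], the swap [M] straddles the
    horizon, and later ones have no effect. *)
Lemma sum_influence_le M : (0 < #|{: dart G}|)%N -> (0 < #|G|)%N -> (M < N)%N ->
  (\sum_(j < N) influence R G N M.+1 j) / (#|G|%:R * #|{: seqs}|%:R) <=
  8 * (max_degree G)%:R * #|G|%:R / m + nonconstant R G N M.
Proof.
move=> m0 n0 MN; have s0 := card_seqs_gt0 m0.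
have n0' : 0 < #|G|%:R :> R by rewrite ltr0n.
have m0' : 0 < m by rewrite ltr0n.
have -> : \sum_(j < N) influence R G N M.+1 j =
    \sum_(0 <= j < M) influence R G N M.+1 j + influence R G N M.+1 M.
  rewrite -(big_mkord predT (influence R G N M.+1)) (big_cat_nat (n := M.+1)) //=.
  rewrite big_nat_recr //= [X in _ + _ + X](_ : _ = 0) ?addr0 //.
  rewrite big_nat big1 // => j /andP[Mj jN].
  exact: influence_late.
rewrite mulrDl; apply: lerD.
  rewrite ler_pdivrMr ?mulr_gt0 // -(ler_pM2l m0').
  have -> (a b : R) : m * (8 * a * #|G|%:R / m * (#|G|%:R * b)) = 8 * a * b * #|G|%:R ^+ 2.
    by field; rewrite gt_eqF.
  by apply: sum_influence => //; rewrite ltnS ltnW.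
rewrite ler_pdivrMr ?mulr_gt0 // /nonconstant mulrCA divfK ?gt_eqF //.
exact: influence_edge.
Qed.

Lemma displacement_le M (s : {perm 'I_N.+1}) : displacement R G M s <= #|G|%:R * #|{: seqs}|%:R.
Proof.
apply: (@le_trans _ _ (\sum_(om : seqs) #|G|%:R)).
  by apply: ler_sum => om _; exact: hamming_le.
by rewrite sumr_const mulr_natr.
Qed.

Lemma displacement_ge0 M (s : {perm 'I_N.+1}) : 0 <= displacement R G M s.
Proof. by apply: sumr_ge0 => om _; exact: hamming_ge0. Qed.

Lemma eq_displacement M (s s' : {perm 'I_N.+1}) : (M <= N.+1)%N ->
  (forall i : 'I_N.+1, (i < M)%N -> s i = s' i) ->
  displacement R G M s = displacement R G M s'.
Proof.
move=> MN ss'; apply: eq_bigr => om _; apply: eq_hamming => //.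
apply: eq_ancestor => i iM; rewrite /extend !ffunE ss' //.
by rewrite inordK // (leq_trans iM).
Qed.

End averaged_influence.

(** * Permutations read off the interchange process *)

Section noise.
Context (R : realType) (p : R) (G : sgraph) d (T : measurableType d)
  (P : probability T R).
Variables (eta0 : G -> T -> bool) (omega : nat -> T -> dart G)
  (zeta : R -> nat -> T -> nat).
Hypothesis model : voter_interchange_model p P eta0 omega zeta.
Local Notation sigmaT := (sigma_algebra_measurable T).
Local Notation m := (#|{: dart G}|%:R : R).
Variable t : R.
Hypothesis t_ge0 : 0 <= t.

Section horizon.
Variables (N M : nat).
Local Notation seqs := {ffun 'I_N.+1 -> dart G}.

Definition positions (w : T) : {ffun 'I_N.+1 -> nat} := [ffun i : 'I_N.+1 => zeta t i w].

(* The positions below [M] are those that matter for the first [M] steps; the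
   remaining ones only serve to complete them to a permutation of [0, N]. *)
Definition matching_perm (v : {ffun 'I_N.+1 -> nat}) : option {perm 'I_N.+1} :=
  [pick s : {perm 'I_N.+1} | [forall i : 'I_N.+1, (i < M)%N ==> (v i == s i)]].

Lemma matching_permP v s : matching_perm v = Some s ->
  forall i : 'I_N.+1, (i < M)%N -> v i = s i.
Proof.
rewrite /matching_perm; case: pickP => // s' /forallP H [<-] i iM.
by have := H i; rewrite iM => /eqP.
Qed.

Lemma measurable_matching o : measurable [set w | matching_perm (positions w) = o].
Proof.
apply: (sigma_fibers sigmaT (fun v => matching_perm v = o)).
apply: (sigma_fibers_ffun sigmaT (X := fun (i : 'I_N.+1) w => zeta t i w)) => i a.
exact: (measurable_zeta model).
Qed.

Lemma sigma_matching o :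
  sigma_interchange zeta [set w | matching_perm (positions w) = o].
Proof.
apply: (sigma_fibers (smallest_sigma_algebra _ _) (fun v => matching_perm v = o)).
apply: (sigma_fibers_ffun (smallest_sigma_algebra _ _)
  (X := fun (i : 'I_N.+1) w => zeta t i w)) => i a.
exact: (sigma_family_fiber (X := fun tk : R * nat => zeta tk.1 tk.2) (i := (t, i : nat))).
Qed.

(** The case without a matching permutation is not charged here; it is confined to the bad event
    below. *)
Definition matching_roots_differ (o : option {perm 'I_N.+1}) (om : seqs) : bool :=
  if o is Some s then roots_differ M s om else false.

(** The permutation is independent of the uniform darts, so [sum_roots_differ] is applied for each
    fixed permutation and then averaged. *)
Lemma prob_roots_differ : (0 < #|{: dart G}|)%N -> (0 < #|G|)%N ->
  prob P [set w | matching_roots_differ (matching_perm (positions w))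
                    (darts_upto omega N w)] <=
  2 * nonconstant R G N M +
  (\sum_s displacement R G M s * prob P [set w | matching_perm (positions w) = Some s])
    / (#|G|%:R * #|{: seqs}|%:R).
Proof.
move=> m0 n0; have s0 : 0 < #|{: seqs}|%:R :> R := card_seqs_gt0 R N m0.
have n0' : 0 < #|G|%:R :> R by rewrite ltr0n.
pose q o := prob P [set w | matching_perm (positions w) = o].
pose Q := matching_roots_differ.
have -> : prob P [set w | Q (matching_perm (positions w)) (darts_upto omega N w)] =
    \sum_o q o * \sum_(om | Q o om) prob P [set w | darts_upto omega N w = om].
  apply: (prob_independent (X := fun w => matching_perm (positions w))
    (Y := darts_upto omega N) Q (vim_zeta_indep model)).
  - exact: measurable_matching.
  - exact: (measurable_darts_upto model).
  - exact: sigma_matching.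
  - exact: sigma_eta_omega_darts.
have q0 o : 0 <= q o by exact: prob_ge0.
have q1 : \sum_o q o <= 1.
  have := prob_fibers P predT measurableT measurable_matching.
  rewrite (eq_bigr q) => [<-|o _]; last by congr prob; apply/seteqP; split=> w //= [].
  by apply: prob_le1; rewrite (_ : mkset _ = setT) //; apply/seteqP; split.
have qQ s : \sum_(om | Q (Some s) om) prob P [set w | darts_upto omega N w = om] <=
    2 * nonconstant R G N M + displacement R G M s / (#|G|%:R * #|{: seqs}|%:R).
  under eq_bigr do rewrite (prob_darts_upto model).
  rewrite big_mkcond /=.
  rewrite (eq_bigr (fun om => (roots_differ M s om)%:R / #|{: seqs}|%:R)); last first.
    by move=> om _; case: ifP; rewrite ?mul1r ?mul0r.
  rewrite -mulr_suml ler_pdivrMr // mulrDl /nonconstant -mulrA divfK ?gt_eqF //.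
  apply: (le_trans (sum_roots_differ R M s n0)); rewrite lerD2l.
  by rewrite invfM mulrA divfK ?gt_eqF.
apply: (@le_trans _ _ (\sum_(o : option {perm 'I_N.+1}) (2 * nonconstant R G N M * q o +
   (if o is Some s then displacement R G M s * q o else 0) / (#|G|%:R * #|{: seqs}|%:R)))).
  apply: ler_sum => o _; rewrite -/(q o); case: o => [s|].
    have := ler_wpM2l (q0 (Some s)) (qQ s); rewrite mulrDr => H; apply: (le_trans H).
    by rewrite mulrC [in X in _ + X]mulrCA mulrA.
  rewrite big_pred0 // mulr0 mul0r addr0 mulr_ge0 //.
  by rewrite mulr_ge0 // nonconstant_ge0.
rewrite big_split /= -mulr_sumr -mulr_suml; apply: lerD.
  by rewrite ler_piMr // mulr_ge0 // nonconstant_ge0.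
rewrite ler_wpM2r ?invr_ge0 ?mulr_ge0 //.
rewrite (bigD1 None) //= add0r.
rewrite [leLHS](reindex_omap Some id) => [|[]//].
by rewrite (eq_bigl predT) // => s; rewrite /= eqxx.
Qed.

End horizon.

Section paths.
Variable tau : nat -> nat -> {RV P >-> R}.
Hypothesis tau_clocks : rate_one_clocks tau.
Hypothesis zeta_path :
  {ae P, forall w, interchange_path (rings tau w) (fun t k => zeta t k w)}.

Lemma sum_count (F : nat -> R) (n : nat) (js : seq nat) : all (fun j => j < n)%N js ->
  \sum_(j <- js) F j = \sum_(j < n) F j * (count_mem (j : nat) js)%:R.
Proof.
elim: js => [|i js IH] /=; first by rewrite big_nil big1 // => j _; rewrite mulr0.
move=> /andP[ilt jslt]; rewrite big_cons IH //.
under [RHS]eq_bigr do rewrite natrD mulrDr.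
rewrite big_split /=; congr (_ + _).
rewrite (bigD1 (Ordinal ilt)) //= eqxx mulr1 big1 ?addr0 // => j ji.
by rewrite (_ : i == j = false) ?mulr0 //; apply: contraNF ji => /eqP ij; apply/eqP/val_inj.
Qed.

Lemma negligible_clocks : P.-negligible [set w | exists jl : nat * nat, tau jl.1 jl.2 w <= 0].
Proof.
have -> : [set w | exists jl : nat * nat, tau jl.1 jl.2 w <= 0] =
    \bigcup_n (if choice.unpickle n is Some jl
               then [set w | tau (jl : nat * nat).1 jl.2 w <= 0] else set0).
  apply/seteqP; split=> w /=.
    by case=> jl H; exists (choice.pickle jl) => //; rewrite choice.pickleK.
  by case=> n _; case: choice.unpickle => // jl H; exists jl.
apply: negligible_bigcup => n; case: choice.unpickle => [jl|]; last exact: negligible_set0.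
exists [set w | tau jl.1 jl.2 w <= 0]; split=> //; first exact: measurable_clock.
transitivity ((prob P [set w | tau jl.1 jl.2 w <= 0])%:E).
  by apply: probE; exact: measurable_clock.
congr EFin; apply/eqP; rewrite eq_le prob_ge0 andbT.
exact: prob_clock.
Qed.

Lemma regular_paths : exists Z : set T, [/\ measurable Z, P Z = 0%E &
  forall w, ~ Z w -> interchange_path (rings tau w) (fun t k => zeta t k w) /\
    forall j l, 0 < tau j l w].
Proof.
have [Z [mZ PZ HZ]] := negligibleU zeta_path negligible_clocks.
exists Z; split=> // w nZ; split.
  by apply: contrapT => H; apply: nZ; apply: HZ; left.
move=> j l; rewrite ltNge; apply/negP => H; apply: nZ; apply: HZ; right.
by exists (j, l).
Qed.

(** A silent clock among those from [M] to [M + L - 1] closes a block containing the first [M]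
    sites, and inside it only the first [K] rings of each clock can occur by time [t]. *)
Lemma matching_path (M L K : nat) w :
  interchange_path (rings tau w) (fun t k => zeta t k w) ->
  (forall j l, 0 < tau j l w) ->
  ~ (forall j, (M <= j < M + L)%N -> tau j 0 w <= t) ->
  ~ (exists j : 'I_(M + L), early tau j K t w) ->
  exists2 s, matching_perm M (positions (M + L) w) = Some s &
    displacement R G M s <=
    \sum_(j < M + L) influence R G (M + L) M j * \sum_(i < K) \1_(early tau j i t) w.
Proof.
move=> path tau0 silent few.
pose ring_time j i : R := \sum_(0 <= l < i.+1) tau j l w.
have ring_ge j i l : (l <= i)%N -> tau j l w <= ring_time j i.
  move=> li; rewrite /ring_time big_mkord (bigD1 (Ordinal (li : (l < i.+1)%N))) //=.
  by rewrite lerDl sumr_ge0 // => k _; exact: ltW.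
have [l lM lt] : exists2 l, (M <= l < M + L)%N & t < tau l 0 w.
  apply: contrapT => H; apply: silent => j jM; rewrite leNgt; apply/negP => jt.
  by apply: H; exists j.
have /andP[Ml lN] := lM.
pose ts j := [seq ring_time j i | i <- iota 0 K].
have [js [jsl zjs jsc]] : exists js : seq nat, [/\ all (fun j => j < l)%N js,
    forall k, (k <= l)%N -> zeta t k w = swaps js k &
    forall j, (count_mem j js <= count (fun u => (u <= t)%R) (ts j))%N].
  apply: (interchange_path_swaps path t_ge0).
    move=> u u0 ut [i uE]; move: ut; rewrite uE leNgt => /negP; apply.
    exact: lt_le_trans lt (ring_ge l i 0%N (leq0n _)).
  move=> j u jl u0 ut [i uE]; apply/mapP; exists i => //; rewrite mem_iota /= add0n.
  rewrite ltnNge; apply/negP => Ki; apply: few.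
  exists (Ordinal (ltn_trans jl lN)) => k kK /=.
  by apply: le_trans ut; rewrite uE; apply: ring_ge; exact: leq_trans kK Ki.
have jsN : all (fun j => j < M + L)%N js.
  by apply/allP => j /(allP jsl) jl; exact: ltn_trans jl lN.
have s0P (i : 'I_(M + L).+1) : (i < M)%N ->
    zeta t i w = swaps_perm (M + L) js i.
  move=> iM; rewrite -[i in RHS]inord_val swaps_perm_val //; last by rewrite -ltnS.
  by rewrite zjs // ltnW // (leq_trans iM).
have [s sE] : exists s, matching_perm M (positions (M + L) w) = Some s.
  rewrite /matching_perm; case: pickP => [s _|/(_ (swaps_perm (M + L) js))]; first by exists s.
  move=> /negP[]; apply/forallP => i; apply/implyP => iM.
  by rewrite ffunE s0P.
exists s => //.
(* The chosen permutation may differ from the product of swaps, but only at positions outside the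
   horizon. *)
have -> : displacement R G M s = displacement R G M (swaps_perm (M + L) js).
  apply: eq_displacement; first by rewrite ltnW // ltnS leq_addr.
  by move=> i iM; apply: val_inj; rewrite /= -s0P // -(matching_permP sE) // ffunE.
apply: le_trans; first exact: displacement_swaps.
rewrite (sum_count _ jsN).
apply: ler_sum => j _; rewrite ler_wpM2l ?influence_ge0 //.
apply: (@le_trans _ _ (count (fun u => u <= t) (ts j))%:R); first by rewrite ler_nat.
rewrite count_map -sum1_count -[X in iota _ X]subn0 -/(index_iota 0 K) big_mkord.
rewrite big_mkcond /= natr_sum; apply: ler_sum => i _.
case: ifP => // ij; rewrite indicE mem_set // => k ki.
exact: le_trans (ring_ge _ _ _ ki) ij.
Qed.

End paths.
End noise.

Lemma geometric_small (R : realType) (c e t : R) : 0 <= c -> 0 < e -> 0 <= t -> t <= 1 / 2 ->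
  exists k : nat, forall i, (k <= i)%N -> c * t ^+ i <= e.
Proof.
move=> c0 e0 t0 t1; exists (Num.bound (c / e)) => i ki.
have ti : t ^+ i <= (1 / 2) ^+ i by rewrite lerXn2r // ?nnegrE //; lra.
apply: (le_trans (ler_wpM2l c0 ti)).
rewrite expr_div_n expr1n mul1r ler_pdivrMr ?exprn_gt0 // mulrC -ler_pdivrMr //.
apply: (le_trans (ltW (archi_boundP _))); first exact: divr_ge0 (ltW e0).
by rewrite -natrX ler_nat (leq_trans ki) // ltnW // ltn_expl.
Qed.

(** * Probability that the noise changes the outcome *)

Section noise_bound.
Context (R : realType) (p : R) (G : sgraph) d (T : measurableType d)
  (P : probability T R).
Variables (eta0 : G -> T -> bool) (omega : nat -> T -> dart G)
  (zeta : R -> nat -> T -> nat).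
Hypothesis model : voter_interchange_model p P eta0 omega zeta.
Local Notation sigmaT := (sigma_algebra_measurable T).
Local Notation m := (#|{: dart G}|%:R : R).
Variable t : R.
Hypotheses (t_ge0 : 0 <= t) (t_le : t <= 1 / 2).
Hypotheses (darts_gt0 : (0 < #|{: dart G}|)%N) (G_gt0 : (0 < #|G|)%N).

Definition outcome_changes : set T :=
  [set w | outcome eta0 omega w <> outcome eta0 (noisy omega zeta t) w].

Lemma measurable_outcome_changes : measurable outcome_changes.
Proof.
have mo := measurable_outcome (measurable_eta0 model) (measurable_omega model).
have mn := measurable_outcome (measurable_eta0 model)
  (fun k a => measurable_noisy model k a t_ge0).
rewrite (_ : outcome_changes = [set w | exists b, ([set w | outcome eta0 omega w = b] `&`
    [set w | outcome eta0 (noisy omega zeta t) w = ~~ b]) w]).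
  by apply: (sigma_exists sigmaT) => b; exact: measurableI.
apply/seteqP; split=> w; rewrite /outcome_changes /mkset.
  move=> H; exists (outcome eta0 omega w); split => //=.
  by move: H; case: (outcome _ omega w); case: outcome.
by case=> b [/= -> ->]; case: b.
Qed.

(** Both outcomes equal the initial opinion of the common root. *)
Lemma outcome_same N M w s : (M <= N)%N ->
  matching_perm M (positions zeta t N w) = Some s ->
  ~~ roots_differ M s (darts_upto omega N w) ->
  outcome eta0 omega w = outcome eta0 (noisy omega zeta t) w.
Proof.
move=> MN sE; rewrite /roots_differ !negb_or !negbK => /and3P[/constant_mapP[x Hx]
  /constant_mapP[y Hy] /forallPn[v]]; rewrite negbK Hx Hy => /eqP xy; subst y.
transitivity (eta0 x w).
  apply: (@consensus_ancestor _ _ _ M) => z; rewrite -(Hx z).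
  by apply: eq_ancestor => i iM; rewrite extend_darts_upto // ltnW // (leq_trans iM).
apply/esym; apply: (@consensus_ancestor _ _ _ M) => z; rewrite -(Hy z).
apply: eq_ancestor => i iM.
have iN : (i < N.+1)%N by rewrite ltnS ltnW // (leq_trans iM).
rewrite /extend !ffunE /noisy -(matching_permP sE) ?inordK // ffunE inordK //.
Qed.

(** The main term is the sum of influences times [2 * t], the bound on the expected rings per clock.
    The bad event counts twice: as a possible change of outcome, and through the trivial bound on
    the displacement there. *)
Lemma prob_outcome_changes_horizon (M L K : nat) :
  prob P outcome_changes <=
  16 * t * ((max_degree G)%:R * #|G|%:R / m) +
  2 * nonconstant R G (M.+1 + L.+1) M.+1 + nonconstant R G (M.+1 + L.+1) M +
  2 * (t ^+ L.+1 + (M.+1 + L.+1)%:R * t ^+ K.+1).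
Proof.
have t2 : 0 <= 2 * t by rewrite mulr_ge0.
have t1 : 2 * t <= 1 by move: t_le; lra.
have [_ [tau [tau_clocks zeta_path]]] := vim_zeta model.
have [Z [mZ PZ HZ]] := regular_paths tau_clocks zeta_path.
set N := (M.+1 + L.+1)%N.
pose NS := [set w | forall j, (M.+1 <= j < M.+1 + L.+1)%N -> tau j 0 w <= t].
pose MR := [set w | exists j : 'I_N, early tau j K t w].
have mNS : measurable NS.
  have -> : NS = [set w | forall i : 'I_L.+1, [set w | tau (M.+1 + i)%N 0 w <= t] w].
    apply/seteqP; split=> w H; first by move=> i; apply: H; rewrite leq_addr ltn_add2l /=.
    move=> j /andP[Mj jN]; have jL : (j - M.+1 < L.+1)%N by rewrite ltn_subLR.
    by have := H (Ordinal jL); rewrite /mkset /= subnKC.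
  by apply: (sigma_forall sigmaT) => i; exact: measurable_clock.
have mMR : measurable MR.
  by apply: (sigma_exists sigmaT) => j; exact: measurable_early.
(* An irregular path, no clock known to be silent beyond the horizon, or a clock that may ring more
   than [K] times. *)
pose bad := Z `|` (NS `|` MR).
have mbad : measurable bad by do 2 (apply: measurableU => //).
have bad_le : prob P bad <= t ^+ L.+1 + N%:R * t ^+ K.+1.
  apply: (le_trans (probU_le _ _ _)) => //; first exact: measurableU.
  rewrite {1}/prob PZ add0r; apply: (le_trans (probU_le _ _ _)) => //.
  apply: lerD; first exact: prob_no_silent.
  apply: (le_trans (prob_exists_le _ _)) => [j|]; first exact: measurable_early.
  apply: (@le_trans _ _ (\sum_(j < N) t ^+ K.+1)).
    by apply: ler_sum => j _; exact: prob_early.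
  by rewrite sumr_const card_ord mulr_natl.
have s0 : 0 < #|{: {ffun 'I_N.+1 -> dart G}}|%:R :> R := card_seqs_gt0 R N darts_gt0.
have n0 : 0 < #|G|%:R :> R by rewrite ltr0n.
pose C : R := #|G|%:R * #|{: {ffun 'I_N.+1 -> dart G}}|%:R.
have C0 : 0 < C by rewrite mulr_gt0.
have good w : ~ bad w -> exists2 s, matching_perm M.+1 (positions zeta t N w) = Some s &
    displacement R G M.+1 s <=
    \sum_(j < N) influence R G N M.+1 j * \sum_(i < K) \1_(early tau j i t) w.
  move=> nbad; have [|path tau0] := HZ w; first by move=> Zw; apply: nbad; left.
  apply: (matching_path G t_ge0 path tau0).
    by move=> H; apply: nbad; right; left.
  by move=> H; apply: nbad; right; right.
pose mp w := matching_perm M.+1 (positions zeta t N w).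
have mmp o : measurable [set w | mp w = o] by exact: (measurable_matching model).
pose differ := [set w | matching_roots_differ M.+1 (mp w) (darts_upto omega N w)].
have mdiffer : measurable differ.
  rewrite (_ : differ = [set w | exists o, ([set w | mp w = o] `&`
     [set w | matching_roots_differ M.+1 o (darts_upto omega N w)]) w]).
    apply: (sigma_exists sigmaT) => o; apply: measurableI => //.
    exact: (measurable_darts_pred model).
  by apply/seteqP; split=> w; rewrite /differ /mkset; [exists (mp w)|case=> o [/= ->]].
have changes_le : prob P outcome_changes <= prob P bad + prob P differ.
  apply: le_trans (probU_le P mbad mdiffer).
  apply: prob_le; [exact: measurable_outcome_changes|exact: measurableU|].
  move=> w ch; case: (pselect (bad w)) => [|nbad]; first by left.
  right; have [s sE _] := good w nbad; rewrite /differ /mkset /mp sE /=.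
  apply: contrapT => /negP nd; apply: ch.
  by apply: (outcome_same _ sE nd); rewrite leq_addr.
have differ_le := prob_roots_differ model t_ge0 N M.+1 darts_gt0 G_gt0.
(* The unit summand carries the bad event, with the maximal displacement [C] as its weight. *)
pose I := (('I_N * 'I_K) + unit)%type.
pose c (x : I) : R := if x is inl ji then influence R G N M.+1 ji.1 else C.
pose B (x : I) : set T := if x is inl ji then early tau ji.1 ji.2 t else bad.
have disp_le : \sum_s displacement R G M.+1 s * prob P [set w | mp w = Some s] <=
    \sum_x c x * prob P (B x).
  apply: prob_indic_le.
  - by move=> s; exact: displacement_ge0.
  - by case=> [ji|_] /=; [exact: influence_ge0|exact: ltW].
  - by move=> s; exact: mmp.
  - by case=> [ji|_] /=; [exact: measurable_early|].
  move=> w; rewrite big_sumType /= [X in _ + X](big_pred1 tt) => [|[]//].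
  have sum_mp : \sum_s displacement R G M.+1 s * \1_[set w | mp w = Some s] w =
      if mp w is Some s then displacement R G M.+1 s else 0.
    case E : (mp w) => [s|]; last first.
      by rewrite big1 // => s _; rewrite indicE memNset ?mulr0 //= E.
    rewrite (bigD1 s) //= indicE mem_set //= mulr1 big1 ?addr0 // => s' ss'.
    rewrite indicE memNset ?mulr0 //= E => -[ss].
    by rewrite ss eqxx in ss'.
  rewrite sum_mp; have pos : 0 <= \sum_(ji : 'I_N * 'I_K)
      influence R G N M.+1 ji.1 * \1_(early tau ji.1 ji.2 t) w :> R.
    by apply: sumr_ge0 => ji _; rewrite mulr_ge0 ?influence_ge0.
  case: (pselect (bad w)) => wb.
    rewrite [in leRHS]indicE (mem_set wb) mulr1.
    case: (mp w) => [s|]; last by rewrite addr_ge0 // ltW.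
    by apply: (le_trans (displacement_le R G _ s)); rewrite lerDr.
  rewrite [X in _ + C * X]indicE (memNset wb) mulr0 addr0.
  have [s sE H] := good w wb; rewrite /mp sE; apply: (le_trans H).
  rewrite -(pair_bigA _ (fun (j : 'I_N) (i : 'I_K) =>
    influence R G N M.+1 j * \1_(early tau j i t) w)) /=.
  by apply: ler_sum => j _; rewrite mulr_sumr.
have cB_le : \sum_x c x * prob P (B x) <=
    2 * t * \sum_(j < N) influence R G N M.+1 j + C * prob P bad.
  rewrite big_sumType /= [X in _ + X](big_pred1 tt) => [|[]//]; rewrite lerD2r.
  rewrite -(pair_bigA _ (fun (j : 'I_N) (i : 'I_K) =>
    influence R G N M.+1 j * prob P (early tau j i t))) /=.
  rewrite mulr_sumr; apply: ler_sum => j _; rewrite -mulr_sumr mulrC.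
  rewrite ler_wpM2r ?influence_ge0 //; apply: le_trans (sum_geometric K t_ge0 t_le).
  by apply: ler_sum => i _; exact: prob_early.
have infl := sum_influence_le R darts_gt0 G_gt0 (_ : (M < N)%N).
have := infl (leq_addr _ _); rewrite -/C => {}infl.
have nc0 := nonconstant_ge0 R G N M.
have : (\sum_s displacement R G M.+1 s * prob P [set w | mp w = Some s]) / C <=
   2 * t * (8 * (max_degree G)%:R * #|G|%:R / m + nonconstant R G N M) + prob P bad.
  rewrite ler_pdivrMr //; apply: (le_trans disp_le); apply: (le_trans cB_le).
  rewrite [leRHS]mulrDl [prob P bad * C]mulrC lerD2r -[leRHS]mulrA ler_wpM2l //.
  by rewrite -ler_pdivrMr.
move=> final.
have tn : 2 * t * nonconstant R G N M <= nonconstant R G N M by rewrite ler_piMl.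
have := le_trans changes_le (lerD (lexx _) differ_le); rewrite -/C.
move: final; rewrite mulrDr => final.
have -> : 16 * t * ((max_degree G)%:R * #|G|%:R / m) =
  2 * t * (8 * (max_degree G)%:R * #|G|%:R / m) by field; rewrite pnatr_eq0 -lt0n.
move: final tn bad_le; rewrite /mp; clear.
set a1 := prob P outcome_changes; set a2 := prob P bad; set a3 := nonconstant R G N M.+1.
set a4 := nonconstant R G N M; set a5 := _ / C; set a6 := 2 * t * (_ / m).
set a7 := 2 * t * a4; set a8 := t ^+ _ + _; lra.
Qed.

End noise_bound.

(** * Counting darts, edges and degrees *)

Section degrees.
Variables (R : realType) (G : sgraph).
Hypotheses (G_card : (1 < #|G|)%N) (G_connected : graph_connected G).
Local Notation m := (#|{: dart G}|%:R : R).

(** The identity map is not constant on two or more vertices, so it disagrees across some dart. *)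
Lemma card_dart_gt0 : (0 < #|{: dart G}|)%N.
Proof.
have [x0 _] : exists x0 : G, x0 \in G by apply/card_gt0P; exact: ltnW.
have nc : ~~ constant_map (id : G -> G).
  apply/negP => /constant_mapP[x H]; move: G_card.
  by rewrite (fintype.eq_card1 (x := x)) // => z; rewrite !inE (H z) eqxx.
have := disagreements_nonconstant R x0 G_connected nc.
rewrite lt0n; apply: contraTneq => /eqP d0; rewrite -ltNge /disagreements big1 //.
by move=> a _; have := card0_eq (eqP d0) a; rewrite inE.
Qed.

Lemma card_edges_gt0 : (0 < #|edges G|)%N.
Proof.
have [a _] : exists a : dart G, a \in {: dart G} by apply/card_gt0P; exact: card_dart_gt0.
by apply/card_gt0P; exists [set (val a).1; (val a).2]%SET; apply/imsetP; exists a.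
Qed.

Lemma card_edges_le : (#|edges G| <= #|{: dart G}|)%N.
Proof. exact: leq_imset_card. Qed.

Lemma degree_ratio_ge : (max_degree G)%:R * #|G|%:R / m <= degree_ratio R G.
Proof.
rewrite /degree_ratio [_ * #|G|%:R]mulrC ler_wpM2l ?mulr_ge0 //.
rewrite lef_pV2 ?posrE ?ltr0n ?card_dart_gt0 ?card_edges_gt0 // ler_nat.
exact: card_edges_le.
Qed.

(** Counting darts by their tails gives at most [#|G|] times the maximum degree. Hence smallness of
    [t * degree_ratio] forces [t] itself to be small. *)
Lemma degree_ratio_ge1 : 1 <= degree_ratio R G.
Proof.
apply: le_trans degree_ratio_ge.
rewrite ler_pdivlMr ?ltr0n ?card_dart_gt0 // mul1r.
have -> : m = \sum_(x : G) \sum_(a : dart G) ((val a).1 == x)%:R.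
  rewrite exchange_big /= -sum1_card natr_sum; apply: eq_bigr => a _.
  by rewrite (bigD1 (val a).1) //= eqxx big1 ?addr0 // => x /negbTE; rewrite eq_sym => ->.
apply: (@le_trans _ _ (\sum_(x : G) (max_degree G)%:R)).
  by apply: ler_sum => x _; exact: sum_tail_eq.
by rewrite sumr_const mulr_natr.
Qed.

End degrees.

(** * Infinite horizon and correlation of the two outcomes *)

Section stability.
Context (R : realType) (p : R) (G : sgraph) d (T : measurableType d)
  (P : probability T R).
Variables (eta0 : G -> T -> bool) (omega : nat -> T -> dart G)
  (zeta : R -> nat -> T -> nat).
Hypothesis model : voter_interchange_model p P eta0 omega zeta.
Hypotheses (G_card : (1 < #|G|)%N) (G_connected : graph_connected G).
Local Notation m := (#|{: dart G}|%:R : R).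

Lemma nonconstant_small (e : R) : 0 < e -> exists2 M0, (0 < M0)%N &
  forall M N, (M0 <= M)%N -> (M <= N.+1)%N -> nonconstant R G N M <= e.
Proof.
move=> e0; pose c := m * #|G|%:R ^+ 2.
have c0 : 0 <= c by rewrite mulr_ge0 // exprn_ge0.
have [x0 _] : exists x0 : G, x0 \in G by apply/card_gt0P; exact: ltnW.
exists (Num.bound (c / e)).+1 => // M N M0 MN.
have D0 := card_dart_gt0 R G_card G_connected.
have M_gt0 : (0 < M)%N by exact: leq_trans M0.
apply: (le_trans (nonconstant_le R x0 D0 G_connected M_gt0 MN)).
rewrite ler_pdivrMr ?ltr0n ?(leq_trans _ M0) // [leRHS]mulrC -ler_pdivrMr //.
have /ltW/le_trans := archi_boundP (divr_ge0 c0 (ltW e0)); apply.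
by rewrite ler_nat ltnW.
Qed.

Lemma prob_outcome : prob P [set w | outcome eta0 omega w = true] = p.
Proof.
have [x0 _] : exists x0 : G, x0 \in G by apply/card_gt0P; exact: ltnW.
apply/eqP; rewrite -subr_eq0 -normr_le0; apply/ler_addgt0Pr => e e0.
have [M M0 H] := nonconstant_small (divr_gt0 e0 (ltr0n R 2)).
rewrite add0r; apply: (le_trans (prob_outcome_le model x0 (leqnSn M))).
have := H M M (leqnn _) (leqnSn _); lra.
Qed.

Lemma prob_outcome_changes_le t : 0 <= t -> t <= 1 / 2 ->
  prob P (outcome_changes eta0 omega zeta t) <= 16 * t * degree_ratio R G.
Proof.
move=> t0 t1; have D0 := card_dart_gt0 R G_card G_connected.
apply: (@le_trans _ _ (16 * t * ((max_degree G)%:R * #|G|%:R / m))); last first.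
  by rewrite ler_wpM2l ?mulr_ge0 // degree_ratio_ge.
apply/ler_addgt0Pr => e e0.
(* The error terms have total weight 2 + 1 + 2 + 2. [K] is chosen last, as its coefficient involves
   [M] and [L]. *)
have e7 : 0 < e / 7 by rewrite divr_gt0.
have [M M0 HM] := nonconstant_small e7.
have [L HL] := geometric_small ler01 e7 t0 t1.
have [K HK] := geometric_small (ler0n R (M.+1 + L.+1)) e7 t0 t1.
have := prob_outcome_changes_horizon model t0 t1 D0 (ltnW G_card) M L K.
have := HM M.+1 (M.+1 + L.+1)%N (leqnSn _) (leq_trans (leq_addr _ _) (leqnSn _)).
have MN : (M <= (M.+1 + L.+1).+1)%N.
  exact: leq_trans (leqnSn _) (leq_trans (leq_addr _ _) (leqnSn _)).
have := HM M (M.+1 + L.+1)%N (leqnn _) MN.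
have := HL L.+1 (leqnSn _); have := HK K.+1 (leqnSn _); rewrite mul1r; lra.
Qed.

(** The event of outcome 1, of probability [p], contains the common event and exceeds it only where
    the outcome changes. *)
Lemma prob_common_outcome t : 0 <= t -> t <= 1 / 2 ->
  `|prob P [set w | outcome eta0 omega w && outcome eta0 (noisy omega zeta t) w] - p|
  <= 16 * t * degree_ratio R G.
Proof.
move=> t0 t1.
have mo := measurable_outcome (measurable_eta0 model) (measurable_omega model).
have mn := measurable_outcome (measurable_eta0 model)
  (fun k a => measurable_noisy model k a t0).
have both : [set w | outcome eta0 omega w && outcome eta0 (noisy omega zeta t) w] =
  [set w | outcome eta0 omega w = true] `&` [set w | outcome eta0 (noisy omega zeta t) w = true].
  by apply/seteqP; split=> w /= => [/andP|[-> ->]].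
have mboth : measurable [set w | outcome eta0 omega w && outcome eta0 (noisy omega zeta t) w].
  by rewrite both; exact: measurableI.
have mch := measurable_outcome_changes model t0.
have := prob_outcome_changes_le t0 t1.
have : prob P [set w | outcome eta0 omega w && outcome eta0 (noisy omega zeta t) w] <= p.
  by rewrite -prob_outcome; apply: prob_le => // w /= /andP[].
have : p <= prob P [set w | outcome eta0 omega w && outcome eta0 (noisy omega zeta t) w]
          + prob P (outcome_changes eta0 omega zeta t).
  rewrite -prob_outcome; apply: le_trans (probU_le P mboth mch).
  apply: prob_le => //; first exact: measurableU.
  move=> w /= o; case E : (outcome eta0 (noisy omega zeta t) w); first by left; apply/andP.
  by right; rewrite /outcome_changes /mkset o E.
by rewrite ler_norml => *; apply/andP; split; lra.
Qed.

Lemma expectation_common_outcome t : 0 <= t ->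
  ('E_P[fun w => ((outcome eta0 omega w)%:R * (outcome eta0 (noisy omega zeta t) w)%:R)%R]
  = (prob P [set w | outcome eta0 omega w && outcome eta0 (noisy omega zeta t) w])%:E)%E.
Proof.
move=> t0.
have mo := measurable_outcome (measurable_eta0 model) (measurable_omega model).
have mn := measurable_outcome (measurable_eta0 model)
  (fun k a => measurable_noisy model k a t0).
have mboth : measurable [set w | outcome eta0 omega w && outcome eta0 (noisy omega zeta t) w].
  have -> : [set w | outcome eta0 omega w && outcome eta0 (noisy omega zeta t) w] =
    [set w | outcome eta0 omega w = true] `&` [set w | outcome eta0 (noisy omega zeta t) w = true].
    by apply/seteqP; split=> w /= => [/andP|[-> ->]].
  exact: measurableI.
rewrite -probE // -(expectation_indic P mboth); congr expectation.
apply/funext => w; rewrite indicE.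
case: (boolP (w \in _)) => [|]; rewrite ?notin_setE ?in_setE /=.
  by move=> /andP[-> ->]; rewrite mulr1.
by case: outcome; case: outcome => //=; rewrite ?mulr0 ?mul0r.
Qed.

End stability.

Theorem corollary1p5 (R : realType) (p : R) (hp0 : 0 < p) (hp1 : p < 1)
  (G : nat -> sgraph)
  (G_card : forall n, #|G n| = n.+2)
  (G_connected : forall n, graph_connected (G n))
  (d : nat -> measure_display) (T : forall n, measurableType (d n))
  (P : forall n, probability (T n) R)
  (eta0 : forall n, G n -> T n -> bool)
  (omega : forall n, nat -> T n -> dart (G n))
  (zeta : forall n, R -> nat -> T n -> nat)
  (model : forall n,
    voter_interchange_model p (P n) (eta0 n) (omega n) (zeta n)) :
  ((ereal_sup (range (fun n => (degree_ratio R (G n))%:E)) < +oo)%E ->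
   forall delta : R, 0 < delta ->
   exists t : R, 0 < t /\
     forall n, (P n [set w | outcome (eta0 n) (omega n) w <>
                  outcome (eta0 n) (noisy (omega n) (zeta n) t) w]
               <= delta%:E)%E)
  /\
  (forall t : nat -> R, (forall n, 0 <= t n) ->
   (t n * degree_ratio R (G n)) @[n --> \oo] --> (0 : R) ->
   ('E_(P n)[fun w => ((outcome (eta0 n) (omega n) w)%:R *
        (outcome (eta0 n) (noisy (omega n) (zeta n) (t n)) w)%:R)%R])%E
     @[n --> \oo] --> p%:E).
Proof.
have card2 n : (1 < #|G n|)%N by rewrite G_card.
have ratio1 n : 1 <= degree_ratio R (G n) := degree_ratio_ge1 R (card2 n) (G_connected n).
split=> [sup_lt delta delta0|t t0 tcvg].
  have ratio_le n : ((degree_ratio R (G n))%:E <=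
      ereal_sup (range (fun n => (degree_ratio R (G n))%:E)))%E.
    by apply: ereal_sup_ubound; exists n.
  (* The supremum is below [+oo] and bounds real numbers from above, so it is a real [B]. *)
  move: sup_lt ratio_le; case: (ereal_sup _) => [B| |] // _ ratio_le; last first.
    by have := ratio_le 0%N; rewrite leeNy_eq.
  have {}ratio_le n : degree_ratio R (G n) <= B by rewrite -lee_fin.
  have B1 : 1 <= B := le_trans (ratio1 0%N) (ratio_le 0%N).
  have B0 : 0 < B by apply: lt_le_trans B1.
  pose t := Num.min (1 / 2) (delta / (16 * B)).
  have t0 : 0 < t by rewrite lt_min !divr_gt0 // mulr_gt0.
  have t1 : t <= 1 / 2 by rewrite ge_min lexx.
  have tB : t <= delta / (16 * B) by rewrite ge_min lexx orbT.
  exists t; split=> // n.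
  rewrite (probE (P n) (measurable_outcome_changes (model n) (ltW t0))) lee_fin.
  apply: (le_trans (prob_outcome_changes_le (model n) (card2 n) (G_connected n) (ltW t0) t1)).
  apply: (@le_trans _ _ (16 * t * B)); first by rewrite ler_wpM2l // mulr_ge0 // ltW.
  by rewrite mulrAC mulrC -ler_pdivlMr // mulr_gt0.
pose q n := prob (P n) [set w | outcome (eta0 n) (omega n) w &&
   outcome (eta0 n) (noisy (omega n) (zeta n) (t n)) w].
rewrite (_ : (fun n => _) = (fun n => (q n)%:E)); last first.
  by apply/funext => n; exact: (expectation_common_outcome (model n) (t0 n)).
apply: cvg_EFin; first by near=> n.
apply/cvgrPdist_le => e e0.
(* The bound 1/2 puts [t n] in the admissible range, since the ratio is at least 1; [e / 16] absorbs
   the constant of the stability estimate. *)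
have e1 : 0 < Num.min (1 / 2) (e / 16) by rewrite lt_min !divr_gt0.
move/cvgrPdist_le : tcvg => /(_ _ e1); apply: filterS => n.
rewrite sub0r normrN ger0_norm ?mulr_ge0 ?(le_trans _ (ratio1 n)) // le_min => /andP[h1 h2].
have tn : t n <= t n * degree_ratio R (G n) by rewrite ler_peMr.
have close := prob_common_outcome (model n) (card2 n) (G_connected n) (t0 n)
  (le_trans tn h1).
rewrite distrC; apply: (le_trans close).
by rewrite -mulrA; lra.
Unshelve. all: by end_near.
Qed.
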